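(* Let $M_P=\{(z,w)\in\mathbb C^2\times\mathbb C : \operatorname{Im} w=P(z,\bar z)\}$ be a holomorphically nondegenerate model hypersurface of finite Catlin multitype, where $P$ is a real-valued polynomial without pluriharmonic terms which is weighted homogeneous of weighted degree $1$ with respect to the multitype weights $\mu_1\ge\mu_2>0$ of $M_P$ at $0$. Suppose that $M_P$ admits a nontrivial $Y\in\mathfrak g_c$ (i.e. a generalized rotation $Y$). Then $P$ can be decomposed as $$P=\sum_{j=1}^M T_j,\qquad T_j=\operatorname{Re}\Big(\sum_{k=1}^{N_j}U_j^{k}\,\overline{V_j^{N_j-k+1}}\Big),$$ where, for each $j$, $\{U_j^1,\dots,U_j^{N_j}\}$ and $\{V_j^1,\dots,V_j^{N_j}\}$ are a symmetric pair of $Y$-chains. Conversely, if $Y$ and $P$ satisfy these conditions, that is, if $P=\sum_{j=1}^M T_j$ with $T_j=\operatorname{Re}\big(\sum_{k=1}^{N_j}U_j^{k}\,\overline{V_j^{N_j-k+1}}\big)$, where for each $j$ the sequences $\{U_j^1,\dots,U_j^{N_j}\}$ and $\{V_j^1,\dots,V_j^{N_j}\}$ are a symmetric pair of $Y$-chains, then $Y\in\mathfrak g_c$.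
   Context: Symmetric pairs of chains. Let $Y$ be a weighted homogeneous (holomorphic) vector field. A pair of finite sequences of holomorphic weighted homogeneous polynomials $\{U^1,\dots,U^n\}$ and $\{V^1,\dots,V^n\}$ is called a symmetric pair of $Y$-chains if $$Y(U^n)=0,\quad Y(U^j)=c_jU^{j+1},\qquad Y(V^n)=0,\quad Y(V^j)=d_jV^{j+1},\qquad j=1,\dots,n-1,$$ where $c_j,d_j$ are nonzero complex constants satisfying $c_j=-\overline{d_{n-j}}$. (Length $n=1$ is allowed.) Multitype. Let $M\subset\mathbb C^3$ be a smooth real hypersurface and $p\in M$ a point of finite type (in the sense of Kohn and Bloom–Graham). Local holomorphic coordinates $(z,w)=(z_1,z_2,w)$, $w=u+iv$, vanishing at $p$, are chosen so that $\{v=0\}$ is tangent to $M$ at $p$. A weight is a pair $\Lambda=(\lambda_1,\lambda_2)$ of rational numbers with $0\le\lambda_j\le\frac12$ and $\lambda_1\ge\lambda_2$. The monomial $c\,z^\alpha\bar z^\beta u^l$ has weighted degree $l+\sum_{i=1}^2(\alpha_i+\beta_i)\lambda_i$; a polynomial is weighted homogeneous ($\Lambda$-homogeneous) of degree $\kappa$ if it is a sum of monomials of weighted degree $\kappa$. $\Lambda$ is distinguished for $M$ if in some such coordinates $M$ is given by $v=P(z,\bar z)+o_\Lambda(1)$, with $P$ a nonzero $\Lambda$-homogeneous polynomial of weighted degree $1$ without pluriharmonic terms, where $o_\Lambda(1)$ denotes a smooth function whose derivatives of weighted order $\le 1$ vanish (at the origin). Let $(\mu_1,\mu_2)$ be the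 infimum of the distinguished weights in the lexicographic order (the multitype weights). The multitype of $M$ at $p$ is $(m_1,m_2)$ with $m_j=1/\mu_j$ (and $m_j=\infty$ if $\mu_j=0$); it is finite if neither $m_j$ is infinite. For a model $M_P$ these notions are applied at $p=0$. Weights of vector fields. The variables $z_1,z_2,w$ have weights $\mu_1,\mu_2,1$, and $\partial_{z_1},\partial_{z_2},\partial_w$ have weights $-\mu_1,-\mu_2,-1$; this defines weighted homogeneous holomorphic vector fields and their weighted degree. $M_P$ is holomorphically nondegenerate (at $0$) if there is no nonzero germ at $0$ of a holomorphic vector field $X$ in $\mathbb C^3$ that is itself (as a complex vector field) tangent to $M_P$. $\operatorname{aut}(M_P,0)$ is the Lie algebra of germs at $0$ of infinitesimal CR automorphisms of $M_P$, i.e. holomorphic vector fields $X$ with $\operatorname{Re}X$ tangent to $M_P$. A holomorphic vector field $f^1\partial_{z_1}+f^2\partial_{z_2}+g\,\partial_w$ is rigid if $f^1,f^2,g$ do not depend on $w$. A generalized rotation is a rigid weighted homogeneous $Y\in\operatorname{aut}(M_P,0)$ of weighted degree $>0$. $\mathfrak g_c\subset\operatorname{aut}(M_P,0)$ is the component consisting of the vector fields of positive weight (in $(0,1)$) commuting with $W=\partial_w$; the generalized rotations are precisely the (nonzero, weighted homogeneous) elements of $\mathfrak g_c$.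
   Formalization: In the converse, Y is additionally assumed to have positive weighted degree and no ∂_w component; without this the converse fails, e.g. Y=∂_w with P=|z_1|²+|z_2|² and chains of length 1. *)

(* Defs.v *)
From HB Require Import structures.
From mathcomp Require Import all_boot all_order all_algebra.
From mathcomp Require Import complex mpoly.
From mathcomp Require Import all_classical all_reals all_analysis.

Set Implicit Arguments.
Unset Strict Implicit.
Unset Printing Implicit Defensive.

Import Order.TTheory GRing.Theory Num.Theory numFieldNormedType.Exports.
Local Open Scope classical_set_scope.
Local Open Scope ring_scope.

(* R[i] has the topology of its norm, as every numFieldType; the library
   declares it for abstract numFieldTypes only. *)
HB.instance Definition _ (R : realType) :=
  PseudoPointedMetric.copy R[i] R[i]^o.

Definition weight : Type := (rat *l rat)%type.

Definition wt (l : weight) (i : 'I_2) : rat := if i == 0 then l.1 else l.2.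

Definition is_weight (l : weight) : Prop :=
  [/\ 0 <= l.2, l.2 <= l.1 & l.1 <= 1 / 2].

(* Weights of the variables (z_1, z_2, w). *)
Definition wt_zw (l : weight) (i : 'I_3) : rat :=
  match fintype.split (i : 'I_(2 + 1)) with inl j => wt l j | inr _ => 1 end.

(* Weights of the variables (z_1, z_2, \bar z_1, \bar z_2). *)
Definition wt_zz (l : weight) (i : 'I_4) : rat :=
  match fintype.split (i : 'I_(2 + 2)) with inl j => wt l j | inr j => wt l j end.

(* Weights of the real variables (Re z_1, Re z_2, Im z_1, Im z_2, u). *)
Definition wt_zu (l : weight) (i : 'I_5) : rat :=
  match fintype.split (i : 'I_(4 + 1)) with inl j => wt_zz l j | inr _ => 1 end.

Definition wdeg n (om : 'I_n -> rat) (m : 'X_{1.. n}) : rat :=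
  \sum_(i < n) (m i)%:R * om i.

(* The zero polynomial is homogeneous of every degree. *)
Definition whomog n (om : 'I_n -> rat) (k : rat) (K : nzRingType)
    (p : {mpoly K[n]}) : Prop :=
  forall m, m \in msupp p -> wdeg om m = k.

Section Hypersurfaces.
Variable R : realType.
Local Notation C := R[i].
Local Notation C2 := 'rV[C]_2.
Local Notation C3 := 'rV[C]_3.

Definition zpart (x : C3) : C2 := @lsubmx C 1 2 1 x.
Definition wpart (x : C3) : C := x 0 ord_max.

Definition ev n (p : {mpoly C[n]}) (x : 'rV[C]_n) : C := p.@[fun i => x 0 i].

(* A polynomial in (z, \bar z) is a polynomial in four variables: the first two
   stand for z, the last two for \bar z. *)
Definition evzz (P : {mpoly C[4]}) (z : C2) : C :=
  ev P (row_mx z (map_mx Num.conj z)).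

Definition real_valued (P : {mpoly C[4]}) : Prop :=
  forall z, complex.Im (evzz P z) = 0.

(* No monomial z^alpha and no monomial \bar z^beta occurs, constants included. *)
Definition no_pluriharmonic (P : {mpoly C[4]}) : Prop :=
  forall m, m \in msupp P ->
    (exists j : 'I_2, m (lshift 2 j) != 0%N) /\
    (exists j : 'I_2, m (rshift 2 j) != 0%N).

Definition model (P : {mpoly C[4]}) : set C3 :=
  [set x | complex.Im (wpart x) = complex.Re (evzz P (zpart x))].

(* Total functions represent germs at 0. *)
Definition holomorphic0 (F : C3 -> C3) : Prop :=
  \forall x \near (0 : C3), differentiable F x.

Definition holo_coordinates (F : C3 -> C3) : Prop :=
  [/\ holomorphic0 F, F 0 = 0 & jacobian F 0 \in unitmx].

Definition partials (s : seq 'I_5) (f : 'rV[R]_5 -> R) : 'rV[R]_5 -> R :=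
  foldr (fun i g x => 'D_(delta_mx 0 i) g x) f s.

Definition smooth0 (f : 'rV[R]_5 -> R) : Prop :=
  \forall x \near (0 : 'rV[R]_5), forall s, differentiable (partials s f) x.

(* f is o_Lambda(1); the derivatives in Re z_j, Im z_j of a given weighted order
   span the same space as those in z_j, \bar z_j. *)
Definition o_wt (l : weight) (f : 'rV[R]_5 -> R) : Prop :=
  smooth0 f /\
  forall s : seq 'I_5, \sum_(i <- s) wt_zu l i <= 1 -> partials s f 0 = 0.

Definition zu_coord (x : C3) : 'rV[R]_5 :=
  let z := zpart x in
  @row_mx R 1 4 1
    (@row_mx R 1 2 2 (map_mx (@complex.Re R) z) (map_mx (@complex.Im R) z))
    (const_mx (complex.Re (wpart x))).

(* Tangency of {v = 0} to M at 0 in the new coordinates needs no separate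
   clause: as all weights are at most 1/2, neither Q nor E has a linear part. *)
Definition distinguished (M : set C3) : set weight :=
  [set l | is_weight l /\
    exists (F : C3 -> C3) (Q : {mpoly C[4]}) (E : 'rV[R]_5 -> R),
      [/\ holo_coordinates F,
          [/\ Q != 0, real_valued Q, no_pluriharmonic Q
            & whomog (wt_zz l) 1 Q],
          o_wt l E
        & \forall x \near (0 : C3),
            M x <-> complex.Im (wpart (F x)) =
                    complex.Re (evzz Q (zpart (F x))) + E (zu_coord (F x))]].

Definition multitype_weights (M : set C3) (mu : weight) : Prop :=
  is_weight mu /\ infimums (distinguished M) mu.

(* The multitype (1 / mu_1, 1 / mu_2) has no infinite entry. *)
Definition finite_multitype_weights (mu : weight) : Prop :=
  0 < mu.1 /\ 0 < mu.2.

(* The map X : C3 -> C3 stands for the vector field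
   X_0 d/dz_1 + X_1 d/dz_2 + X_2 d/dw. *)

(* X applied to the defining function (w - \bar w) / 2i - P(z, \bar z). *)
Definition act_rho (P : {mpoly C[4]}) (X : C3 -> C3) (x : C3) : C :=
  wpart (X x) / (2 * 'i)
  - \sum_(j < 2) zpart (X x) 0 j * evzz (mderiv (lshift 2 j) P) (zpart x).

Definition holo_nondegenerate (P : {mpoly C[4]}) : Prop :=
  forall X : C3 -> C3, holomorphic0 X ->
    (\forall x \near (0 : C3), model P x -> act_rho P X x = 0) ->
    \forall x \near (0 : C3), X x = 0.

Definition aut (P : {mpoly C[4]}) (X : C3 -> C3) : Prop :=
  holomorphic0 X /\
  \forall x \near (0 : C3), model P x -> complex.Re (act_rho P X x) = 0.

Definition vf_homog (mu : weight) (nu : rat) (X : C3 -> C3) : Prop :=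
  exists F : 'I_3 -> {mpoly C[3]},
    (forall i, whomog (wt_zw mu) (nu + wt_zw mu i) (F i)) /\
    \forall x \near (0 : C3), forall i, X x 0 i = ev (F i) x.

Definition lie_bracket (X Y : C3 -> C3) (x : C3) : C3 :=
  'D_(X x) Y x - 'D_(Y x) X x.

Definition d_w : C3 -> C3 := fun=> delta_mx 0 ord_max.

Definition gc_homog (P : {mpoly C[4]}) (mu : weight) (X : C3 -> C3) : Prop :=
  [/\ aut P X,
      \forall x \near (0 : C3), lie_bracket d_w X x = 0
    & exists nu : rat, [/\ 0 < nu, nu < 1 & vf_homog mu nu X]].

(* g_c is the sum of its weighted homogeneous components. *)
Definition gc (P : {mpoly C[4]}) (mu : weight) (X : C3 -> C3) : Prop :=
  exists (n : nat) (Z : 'I_n -> C3 -> C3),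
    (forall i, gc_homog P mu (Z i)) /\
    \forall x \near (0 : C3), X x = \sum_(i < n) Z i x.

(* The derivative Y(U) of a polynomial U in z, regarded as a function of
   (z, w). *)
Definition act_poly (Y : C3 -> C3) (U : {mpoly C[2]}) (x : C3) : C :=
  \sum_(j < 2) zpart (Y x) 0 j * ev (mderiv j U) (zpart x).

(* The chains are U 1, ..., U n and V 1, ..., V n; other values are unused. *)
Definition symmetric_pair (mu : weight) (Y : C3 -> C3) (n : nat)
    (U V : nat -> {mpoly C[2]}) : Prop :=
  [/\ (1 <= n)%N,
      forall k, (1 <= k <= n)%N ->
        (exists a, whomog (wt mu) a (U k)) /\ (exists b, whomog (wt mu) b (V k)),
      \forall x \near (0 : C3), act_poly Y (U n) x = 0,
      \forall x \near (0 : C3), act_poly Y (V n) x = 0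
    & exists c d : nat -> C, forall j, (1 <= j < n)%N ->
        [/\ c j != 0, d j != 0, c j = - Num.conj (d (n - j)%N),
            \forall x \near (0 : C3),
              act_poly Y (U j) x = c j * ev (U j.+1) (zpart x)
          & \forall x \near (0 : C3),
              act_poly Y (V j) x = d j * ev (V j.+1) (zpart x)]].

Definition chain_decomposition (mu : weight) (Y : C3 -> C3)
    (P : {mpoly C[4]}) : Prop :=
  exists (M : nat) (N : 'I_M -> nat) (U V : 'I_M -> nat -> {mpoly C[2]}),
    (forall j, symmetric_pair mu Y (N j) (U j) (V j)) /\
    forall z : C2,
      complex.Re (evzz P z) =
      \sum_(j < M) complex.Re (\sum_(1 <= k < (N j).+1)
        ev (U j k) z * Num.conj (ev (V j (N j - k + 1)%N) z)).

End Hypersurfaces.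

(* Main.v *)
Require Import Defs.
From HB Require Import structures.
From mathcomp Require Import all_boot all_order all_algebra.
From mathcomp Require Import complex mpoly.
From mathcomp Require Import all_classical all_reals all_analysis.

(** Expand P in powers of the conjugate variables, P = sum_be p_be(z) zbar^be,
    with p_be holomorphic.  A rigid field Y = f_1 d/dz_1 + f_2 d/dz_2 acts on
    holomorphic polynomials by the derivation D = sum_j f_j d_j, so that
    YP = sum_be (D p_be) zbar^be.

    Tangency of Re Y to the model is the identity Re (YP) = 0: on the
    model w = u + iP, and a d/dw component g of Y contributes to Re only terms
    pluriharmonic in z, which do not occur in YP as P has none and f vanishes
    at 0.  Comparing coefficients (a polynomial in z and zbar that vanishes
    near 0 is 0, [conj_pair_eq0]) turns Re (YP) = 0 into the skewness relation

      (D p_be)_al + conj (D p_al)_be = 0          for all al, be,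

    and, as the coefficient matrix of P is Hermitian, into

      D p_be = - sum_ga conj ((D z^ga)_be) p_ga.

    Thus D preserves the finite dimensional span of the p_be.  It raises
    weights by nu > 0, so it is nilpotent there, and the required
    decomposition is a Jordan decomposition of this nilpotent operator, with
    chains U^k = D^(k-1) e and dual chains V^l read off from the tensor P.
    No Jordan basis has to be chosen: [split_chain] takes a nonzero p_be with the
    longest D-orbit, projects the tensor along D onto the span of this orbit,
    recognises the projected part as one symmetric pair of chains, and leaves a
    tensor of the same kind with fewer nonzero p_be.  Induction on their
    number gives [chain_decomposition_of_skew].

    Conversely, let P be a sum of chain terms.  Each p_be is then a linear
    combination of the U's and V's.  Expand Y in powers of w: the components of
    positive power in w annihilate every U and V, hence every p_be, hence P;
    they are complex tangent to the model and vanish by holomorphic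
    nondegeneracy.  So Y is rigid.  Inside each chain term the sums telescope
    because c_j = - conj d_(n-j) ([chain_telescope]), which is the skewness
    relation again, and Re Y is tangent.  It remains to bound the weight: if
    nu >= 1, skewness makes D p_be vanish for weight reasons, so Y = 0 by
    nondegeneracy, and 0 belongs to g_c as the empty sum. *)

Set Implicit Arguments.
Unset Strict Implicit.
Unset Printing Implicit Defensive.

Import Order.TTheory GRing.Theory Num.Theory numFieldNormedType.Exports.
Local Open Scope classical_set_scope.
Local Open Scope ring_scope.

(** * Polynomials in two groups of variables *)

Section Slices.
Variables (K : comNzRingType) (a b : nat).
Implicit Types (Q : {mpoly K[(a + b)%N]}) (m : 'X_{1..a + b}).
Implicit Types (al : 'X_{1..a}) (be : 'X_{1..b}).

Definition mcat al be : 'X_{1..a + b} :=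
  [multinom match fintype.split i with inl j => al j | inr j => be j end
     | i < a + b].
Definition mleft m : 'X_{1..a} := [multinom m (lshift b i) | i < a].
Definition mright m : 'X_{1..b} := [multinom m (rshift a i) | i < b].

Lemma mcatl al be i : mcat al be (lshift b i) = al i.
Proof. by rewrite mnmE -[lshift b i]/(unsplit (inl i)) unsplitK. Qed.

Lemma mcatr al be i : mcat al be (rshift a i) = be i.
Proof. by rewrite mnmE -[rshift a i]/(unsplit (inr i)) unsplitK. Qed.

Lemma mcatK m : mcat (mleft m) (mright m) = m.
Proof.
apply/mnmP => i; rewrite -(splitK i); case: (fintype.split i) => j /=.
  by rewrite mcatl mnmE.
by rewrite mcatr mnmE.
Qed.

Lemma mleft_cat al be : mleft (mcat al be) = al.
Proof. by apply/mnmP => i; rewrite mnmE mcatl. Qed.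

Lemma mright_cat al be : mright (mcat al be) = be.
Proof. by apply/mnmP => i; rewrite mnmE mcatr. Qed.

Lemma mcat_eq m al be :
  (m == mcat al be) = (mleft m == al) && (mright m == be).
Proof.
apply/eqP/andP => [->|[/eqP<- /eqP<-]]; last by rewrite mcatK.
by rewrite mleft_cat mright_cat.
Qed.

(** The coefficient of the monomial be of the second group of variables. *)
Definition slice be Q : {mpoly K[a]} :=
  \sum_(m <- msupp Q | mright m == be) Q@_m *: 'X_[mleft m].

Lemma mcoeff_slice be Q al : (slice be Q)@_al = Q@_(mcat al be).
Proof.
rewrite raddf_sum /= [in RHS](mpolyE Q) raddf_sum /= big_mkcond /=.
apply: eq_bigr => m _; rewrite [in RHS]mcoeffZ mcoeffX mcat_eq andbC.
by case: ifP => _; rewrite ?mulr0 //= mcoeffZ mcoeffX.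
Qed.

Lemma slice_deriv be i Q : slice be (Q^`M(lshift b i)) = (slice be Q)^`M(i).
Proof.
apply/mpolyP => al; rewrite mcoeff_slice !mcoeff_deriv mcoeff_slice mcatl.
congr (_@_ _ *+ _); apply/mnmP => k; rewrite -(splitK k).
case: (fintype.split k) => j /=; rewrite mnmDE mnm1E.
  by rewrite !mcatl mnmDE mnm1E eq_lshift.
by rewrite !mcatr eq_lrshift addn0.
Qed.

Lemma meval_slice be Q x :
  (slice be Q).@[x] =
  \sum_(m <- msupp Q | mright m == be)
     Q@_m * \prod_i x i ^+ m (lshift b i).
Proof.
rewrite raddf_sum /=; apply: eq_bigr => m _; rewrite mevalZ mevalX.
by congr (_ * _); apply: eq_bigr => i _; rewrite mnmE.
Qed.

Lemma meval_slices Q (S : seq 'X_{1..b}) x : uniq S ->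
  (forall be, be \notin S -> slice be Q = 0) ->
  Q.@[x] = \sum_(be <- S) (slice be Q).@[fun i => x (lshift b i)] *
                          \prod_i x (rshift a i) ^+ be i.
Proof.
move=> uS S0.
under eq_bigr => be _ do rewrite meval_slice mulr_suml big_mkcond /=.
rewrite exchange_big /= mevalE; apply: eq_big_seq => m mQ.
have mS : mright m \in S.
  apply: contraLR mQ => /S0 /mpolyP /(_ (mleft m)).
  by rewrite mcoeff_slice mcatK mcoeff0 => /eqP; rewrite mcoeff_eq0.
rewrite (big_rem _ mS) /= eqxx [X in _ = _ + X]big_seq [X in _ = _ + X]big1 ?addr0.
  rewrite -mulrA big_split_ord /=; congr (_ * (_ * _)).
  by apply: eq_bigr => i _; rewrite mnmE.
move=> be; rewrite mem_rem_uniq // inE => /andP [/negPf ne _].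
by rewrite eq_sym ne.
Qed.

Definition slices Q : seq 'X_{1..b} := undup [seq mright m | m <- msupp Q].

Lemma slice_out Q be : be \notin slices Q -> slice be Q = 0.
Proof.
rewrite mem_undup => nbe; rewrite /slice big_seq_cond big1 // => m.
case/andP => mQ /eqP mbe; case/negP: nbe; rewrite -mbe.
by apply/mapP; exists m.
Qed.

Definition tensor (p : {mpoly K[a]}) (q : {mpoly K[b]}) : {mpoly K[(a + b)%N]} :=
  \sum_(al <- msupp p) \sum_(be <- msupp q)
    (p@_al * q@_be) *: 'X_[mcat al be].

Lemma mcoeff_tensor p q al be : (tensor p q)@_(mcat al be) = p@_al * q@_be.
Proof.
rewrite [in RHS](mpolyE p) [in RHS](mpolyE q) !raddf_sum /=.
rewrite mulr_suml; apply: eq_bigr => al' _.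
rewrite raddf_sum mulr_sumr; apply: eq_bigr => be' _.
rewrite /= !mcoeffZ !mcoeffX mcat_eq mleft_cat mright_cat.
by case: eqP; case: eqP => _ _; rewrite /= ?(mulr1, mulr0, mul0r).
Qed.

Lemma meval_tensor p q x :
  (tensor p q).@[x] =
  p.@[fun i => x (lshift b i)] * q.@[fun i => x (rshift a i)].
Proof.
rewrite raddf_sum !mevalE mulr_suml /=; apply: eq_bigr => al _.
rewrite raddf_sum mulr_sumr; apply: eq_bigr => be _.
rewrite /= mevalZ mevalX big_split_ord /= mulrACA.
by congr (_ * _ * (_ * _)); apply: eq_bigr => i _; rewrite ?mcatl ?mcatr.
Qed.

End Slices.

(** * The identity principle *)

Lemma poly_eq0_on (K : idomainType) (T : set K) (p : {poly K}) :
  (forall N, exists s, [/\ uniq s, size s = N & forall x, x \in s -> T x]) ->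
  (forall x, T x -> p.[x] = 0) -> p = 0.
Proof.
move=> Tinf p0; apply/eqP; apply: contraT => pn0.
have [s [us ss sT]] := Tinf (size p).
have := max_poly_roots pn0 _ us; rewrite ss ltnn; apply.
by apply/allP => x /sT /p0; rewrite /root => ->.
Qed.

(** Induction on the number of variables: with all variables but the last fixed
    in T, a one-variable polynomial has infinitely many zeros, so its
    coefficients, which are the slices in the last variable, vanish. *)
Lemma mpoly_eq0_on (K : idomainType) (T : set K) n (p : {mpoly K[n]}) :
  (forall N, exists s, [/\ uniq s, size s = N & forall x, x \in s -> T x]) ->
  (forall x, (forall i, T (x i)) -> p.@[x] = 0) -> p = 0.
Proof.
move=> Tinf; elim: n p => [|n IH] p.
  have p0E x : p.@[x] = p@_0%MM.
    rewrite mevalE [in RHS](mpolyE p) raddf_sum /=; apply: eq_bigr => m _.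
    rewrite big_ord0 mcoeffZ mcoeffX; congr (_ * _).
    by rewrite (_ : m == 0%MM) //; apply/eqP/mnmP => -[].
  move=> /(_ (fun=> 0)); rewrite p0E => p00.
  have {}p00 : p@_0%MM = 0 by apply: p00; case.
  apply/mpolyP => m; rewrite mcoeff0 (_ : m = 0%MM) //.
  by apply/mnmP; case.
move: p; rewrite -addn1 => p p0.
suff sl be : slice be p = 0.
  apply/mpolyP => m; move/mpolyP: (sl (mright m)) => /(_ (mleft m)).
  by rewrite mcoeff_slice mcatK !mcoeff0.
apply: IH => x xT; pose y t (i : 'I_(n + 1)) :=
  match fintype.split i with inl j => x j | inr _ => t end.
pose q : {poly K} := \sum_(m <- msupp p)
  (p@_m * \prod_i x i ^+ m (lshift 1 i)) *: 'X^(m (rshift n ord0)).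
have q0 : q = 0.
  apply: (poly_eq0_on Tinf) => t Tt; rewrite -[RHS](p0 (y t)); last first.
    by move=> i; rewrite /y; case: (fintype.split i).
  rewrite /q horner_sum mevalE; apply: eq_bigr => m _.
  rewrite hornerZ hornerXn big_split_ord /= big_ord1 mulrA.
  congr (_ * _ * _); last by rewrite /y -[rshift _ _]/(unsplit (inr _)) unsplitK.
  by apply: eq_bigr => i _; rewrite /y -[lshift _ i in RHS]/(unsplit (inl _)) unsplitK.
move/polyP: q0 => /(_ (be ord0)); rewrite coef0 coef_sum meval_slice => q0.
rewrite -[RHS]q0 big_mkcond; apply: eq_bigr => m _; rewrite coefZ coefXn.
rewrite (_ : (mright m == be) = (be ord0 == m (rshift n ord0))).
  by case: eqP => _; rewrite ?mulr1 ?mulr0.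
apply/eqP/eqP => [<-|be0]; first by rewrite mnmE.
by apply/mnmP => i; rewrite mnmE ord1.
Qed.

Lemma infinite_small_reals (C : numFieldType) (e : C) : 0 < e ->
  forall N, exists s : seq C, [/\ uniq s, size s = N &
    forall x, x \in s -> x \is Num.real /\ `|x| < e].
Proof.
move=> e0 N; exists [seq e / k.+2%:R | k <- iota 0 N]; split.
- rewrite map_inj_uniq ?iota_uniq // => k l /(mulfI (lt0r_neq0 e0)) /invr_inj.
  by move/eqP; rewrite eqr_nat => /eqP [].
- by rewrite size_map size_iota.
move=> x /mapP [k _ ->]; have k0 : 0 < k.+2%:R :> C by rewrite ltr0n.
have x0 : 0 < e / k.+2%:R by rewrite divr_gt0.
rewrite realE (ltW x0) gtr0_norm //; split=> //.
by rewrite ltr_pdivrMr // ltr_pMr // ltr1n.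
Qed.

Lemma mpoly_eq0_near (C : numFieldType) n (p : {mpoly C[n]}) (e : C) :
  0 < e -> (forall x, (forall i, `|x i| < e) -> p.@[x] = 0) -> p = 0.
Proof.
move=> e0 p0; apply: (@mpoly_eq0_on _ [set t | `|t| < e]) p0 => N.
have [s [us ss sT]] := infinite_small_reals e0 N.
by exists s; split=> // x /sT [].
Qed.

Lemma mpoly_eq0_all (C : numFieldType) n (p : {mpoly C[n]}) :
  (forall x, p.@[x] = 0) -> p = 0.
Proof. by move=> p0; apply: (@mpoly_eq0_near _ _ p 1) => // x _; apply: p0. Qed.

Lemma meval_conj (C : numClosedFieldType) n (p : {mpoly C[n]}) x :
  Num.conj p.@[x] = (map_mpoly Num.conj p).@[fun i => Num.conj (x i)].
Proof.
rewrite mevalE rmorph_sum /map_mpoly /mmap [in RHS]raddf_sum /=.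
apply: eq_bigr => m _; rewrite mevalM mevalC rmorphM rmorph_prod /=; congr (_ * _).
by rewrite mmap1_id mevalX; apply: eq_bigr => i _; rewrite rmorphXn.
Qed.

(** The point (z, conj z) at which a polynomial in (z, zbar) is evaluated. *)
Definition conj_pair (C : numClosedFieldType) n (z : 'I_n -> C)
    (k : 'I_(n + n)) : C :=
  match fintype.split k with inl j => z j | inr j => Num.conj (z j) end.

Lemma conj_pairl (C : numClosedFieldType) n (z : 'I_n -> C) j :
  conj_pair z (lshift n j) = z j.
Proof. by rewrite /conj_pair -[lshift n j]/(unsplit (inl j)) unsplitK. Qed.

Lemma conj_pairr (C : numClosedFieldType) n (z : 'I_n -> C) j :
  conj_pair z (rshift n j) = Num.conj (z j).
Proof. by rewrite /conj_pair -[rshift n j]/(unsplit (inr j)) unsplitK. Qed.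

(** In the real coordinates z = s + it, zbar = s - it the hypothesis says that a
    polynomial vanishes at small real (s, t), hence identically; as every
    complex (z, zbar) is of this form for some complex (s, t), Q vanishes. *)
Lemma conj_pair_eq0 (C : numClosedFieldType) n (Q : {mpoly C[(n + n)%N]})
    (e : C) : 0 < e ->
  (forall z, (forall i, `|z i| < e) -> Q.@[conj_pair z] = 0) -> Q = 0.
Proof.
move=> e0 Q0.
pose phi (v : 'I_(n + n) -> C) (k : 'I_(n + n)) := match fintype.split k with
  | inl j => v (lshift n j) + 'i * v (rshift n j)
  | inr j => v (lshift n j) - 'i * v (rshift n j) end.
pose Q' := Q \mPo [tuple match fintype.split k with
  | inl j => 'X_(lshift n j) + 'i *: 'X_(rshift n j)
  | inr j => 'X_(lshift n j) - 'i *: 'X_(rshift n j) end | k < (n + n)%N].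
have Q'E v : Q'.@[v] = Q.@[phi v].
  rewrite comp_mpoly_meval; apply: meval_eq => k; rewrite tnth_mktuple /phi.
  by case: (fintype.split k) => j /=; rewrite mevalD ?mevalN mevalZ !mevalXU.
have phil v j : phi v (lshift n j) = v (lshift n j) + 'i * v (rshift n j).
  by rewrite /phi -[X in fintype.split X]/(unsplit (inl j)) unsplitK.
have phir v j : phi v (rshift n j) = v (lshift n j) - 'i * v (rshift n j).
  by rewrite /phi -[X in fintype.split X]/(unsplit (inr j)) unsplitK.
have e2 : 0 < e / 2 by rewrite divr_gt0.
have Q'0 : Q' = 0.
  apply: (mpoly_eq0_on (infinite_small_reals e2)) => v vT; rewrite Q'E.
  rewrite -[RHS](Q0 (fun i => phi v (lshift n i))); last first.
    move=> j; rewrite phil (splitr e) (le_lt_trans (ler_normD _ _)) //.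
    rewrite normrM normCi mul1r ltrD //.
      by case: (vT (lshift n j)).
    by case: (vT (rshift n j)).
  apply: meval_eq => k; rewrite -(splitK k); case: (fintype.split k) => j /=.
    by rewrite conj_pairl.
  rewrite conj_pairr phil phir rmorphD rmorphM /= conjCi mulNr.
  have [rl _] := vT (lshift n j); have [rr _] := vT (rshift n j).
  by rewrite !conj_Creal.
(* The complex point (s, t) with s + it and s - it the two halves of x. *)
apply: mpoly_eq0_all => x.
pose v k := match fintype.split k with
  | inl j => (x (lshift n j) + x (rshift n j)) / 2
  | inr j => (x (lshift n j) - x (rshift n j)) / (2 * 'i) end.
have vl j : v (lshift n j) = (x (lshift n j) + x (rshift n j)) / 2.
  by rewrite /v -[X in fintype.split X]/(unsplit (inl j)) unsplitK.
have vr j : v (rshift n j) = (x (lshift n j) - x (rshift n j)) / (2 * 'i).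
  by rewrite /v -[X in fintype.split X]/(unsplit (inr j)) unsplitK.
have half (y y' : C) : (y + y') / 2 + (y - y') / 2 = y.
  by rewrite -mulrDl addrACA subrr addr0 -mulr2n -[y *+ 2]mulr_natr mulfK // pnatr_eq0.
have iv (y : C) : 'i * (y / (2 * 'i)) = y / 2.
  by rewrite invfM mulrCA ['i * _]mulrCA mulfV ?neq0Ci ?mulr1.
have -> : x = phi v.
  apply/funext => k; rewrite -(splitK k); case: (fintype.split k) => j /=.
    by rewrite phil vl vr iv half.
  by rewrite phir vl vr iv [x (lshift n j) + _]addrC -[x (lshift n j) - _]opprB mulNr opprK half.
by rewrite -Q'E Q'0 meval0.
Qed.

(** * Sesquilinear tensors *)

Section Hermitian.
Variables (C : numClosedFieldType) (n : nat).
Implicit Types (U V : {mpoly C[n]}) (Q : {mpoly C[(n + n)%N]}).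

(** The polynomial U(z) conj (V(z)). *)
Definition herm U V : {mpoly C[(n + n)%N]} :=
  tensor U (map_mpoly Num.conj V).

Lemma mcoeff_herm U V al be :
  (herm U V)@_(mcat al be) = U@_al * Num.conj V@_be.
Proof. by rewrite mcoeff_tensor mcoeff_map_mpoly. Qed.

Lemma meval_herm U V z :
  (herm U V).@[conj_pair z] = U.@[z] * Num.conj V.@[z].
Proof.
rewrite meval_tensor meval_conj; congr (_ * _); apply: meval_eq => i.
  exact: conj_pairl.
exact: conj_pairr.
Qed.

(** The polynomial whose values are the conjugates of those of Q: conjugate the
    coefficients and exchange z with zbar. *)
Definition conj_swap Q : {mpoly C[(n + n)%N]} :=
  \sum_(m <- msupp Q)
    Num.conj Q@_m *: 'X_[mcat (@mright n n m) (@mleft n n m)].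

Lemma mcoeff_conj_swap Q al be :
  (conj_swap Q)@_(mcat al be) = Num.conj Q@_(mcat be al).
Proof.
rewrite raddf_sum [in RHS](mpolyE Q) (raddf_sum (mcoeff _)) (rmorph_sum Num.conj) /=.
apply: eq_bigr => m _; rewrite !mcoeffZ !mcoeffX !mcat_eq mleft_cat mright_cat.
by rewrite andbC rmorphM rmorph_nat.
Qed.

Lemma meval_conj_swap Q z :
  (conj_swap Q).@[conj_pair z] = Num.conj Q.@[conj_pair z].
Proof.
rewrite raddf_sum mevalE rmorph_sum /=; apply: eq_bigr => m _.
rewrite mevalZ mevalX rmorphM rmorph_prod /=; congr (_ * _).
rewrite !big_split_ord /= mulrC; congr (_ * _); apply: eq_bigr => i _.
  by rewrite mcatr mnmE conj_pairr conj_pairl rmorphXn.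
by rewrite mcatl mnmE conj_pairr conj_pairl rmorphXn /= conjCK.
Qed.

End Hermitian.

(** * Weighted homogeneous polynomials *)

Section Homogeneous.
Variables (n : nat) (om : 'I_n -> rat) (K : nzRingType).
Implicit Types (p q : {mpoly K[n]}) (m : 'X_{1..n}) (k : rat).

Lemma wdegD m1 m2 : wdeg om (m1 + m2)%MM = wdeg om m1 + wdeg om m2.
Proof.
rewrite /wdeg -big_split; apply: eq_bigr => i _.
by rewrite mnmDE natrD mulrDl.
Qed.

Lemma wdeg1 i : wdeg om U_(i) = om i.
Proof.
rewrite /wdeg (bigD1 i) //= mnm1E eqxx mul1r big1 ?addr0 // => j ji.
by rewrite mnm1E eq_sym (negPf ji) mul0r.
Qed.

Lemma wdeg_ge0 m : (forall i, 0 <= om i) -> 0 <= wdeg om m.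
Proof. by move=> om0; apply: sumr_ge0 => i _; rewrite mulr_ge0 ?ler0n. Qed.

Lemma wdeg_gt0 m : (forall i, 0 < om i) -> m != 0%MM -> 0 < wdeg om m.
Proof.
move=> om0 mn0; have /existsP [i mi] : [exists i, m i != 0%N].
  apply: contraNT mn0 => /existsPn m0; apply/eqP/mnmP => i; rewrite mnm0E.
  by apply/eqP; rewrite -[_ == _]negbK; apply: m0.
rewrite /wdeg (bigD1 i) //= ltr_pwDl ?mulr_gt0 ?ltr0n ?lt0n //.
by apply: sumr_ge0 => j _; rewrite mulr_ge0 ?ler0n // ltW.
Qed.

Lemma whomog_coeff k p m : whomog om k p -> p@_m != 0 -> wdeg om m = k.
Proof. by rewrite -mcoeff_msupp => ph /ph. Qed.

Lemma coeff_whomog k p :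
  (forall m, p@_m != 0 -> wdeg om m = k) -> whomog om k p.
Proof. by move=> ph m; rewrite mcoeff_msupp; apply: ph. Qed.

Lemma whomog0 k : whomog om k (0 : {mpoly K[n]}).
Proof. by move=> m; rewrite msupp0. Qed.

Lemma whomogD k p q : whomog om k p -> whomog om k q -> whomog om k (p + q).
Proof.
move=> ph qh; apply: coeff_whomog => m; rewrite mcoeffD.
have [p0|/(whomog_coeff ph) //] := eqVneq p@_m 0.
by rewrite p0 add0r => /(whomog_coeff qh).
Qed.

Lemma whomogZ k c p : whomog om k p -> whomog om k (c *: p).
Proof.
move=> ph; apply: coeff_whomog => m; rewrite mcoeffZ => cp.
by apply: (whomog_coeff ph); apply: contraNneq cp => ->; rewrite mulr0.
Qed.

Lemma whomogN k p : whomog om k p -> whomog om k (- p).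
Proof. by rewrite -scaleN1r; apply: whomogZ. Qed.

Lemma whomog_sum k (I : Type) (r : seq I) (P : pred I) (F : I -> {mpoly K[n]}) :
  (forall i, P i -> whomog om k (F i)) ->
  whomog om k (\sum_(i <- r | P i) F i).
Proof. by move=> Fh; elim/big_ind: _ => //; [exact: whomog0|exact: whomogD]. Qed.

Lemma whomogM k l p q :
  whomog om k p -> whomog om l q -> whomog om (k + l) (p * q).
Proof.
move=> ph qh m /msuppM_le /allpairsP [[m1 m2] /= [m1p m2q ->]].
by rewrite wdegD (ph _ m1p) (qh _ m2q).
Qed.

Lemma whomogX m : whomog om (wdeg om m) ('X_[m] : {mpoly K[n]}).
Proof. by move=> m'; rewrite msuppX inE => /eqP ->. Qed.

Lemma whomog_deriv k i p : whomog om k p -> whomog om (k - om i) p^`M(i).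
Proof.
move=> ph; apply: coeff_whomog => m; rewrite mcoeff_deriv => pm.
apply/eqP; rewrite eq_sym subr_eq -{1}(wdeg1 i) -wdegD eq_sym.
apply/eqP/(whomog_coeff ph).
by apply: contraNneq pm => ->; rewrite mul0rn.
Qed.

End Homogeneous.

Lemma wdeg_mcat a b (om : 'I_(a + b) -> rat) (al : 'X_{1..a}) (be : 'X_{1..b}) :
  wdeg om (mcat al be) =
  wdeg (fun i => om (lshift b i)) al + wdeg (fun i => om (rshift a i)) be.
Proof.
rewrite /wdeg big_split_ord /=.
by congr (_ + _); apply: eq_bigr => i _; rewrite ?mcatl ?mcatr.
Qed.

Lemma eq_wdeg n (om om' : 'I_n -> rat) m : om =1 om' -> wdeg om m = wdeg om' m.
Proof. by move=> e; apply: eq_bigr => i _; rewrite e. Qed.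

(** * Splitting a skew tensor into chains *)

Section ChainDecomposition.
Variables (C : numClosedFieldType) (n : nat) (om : 'I_n -> rat).
Variables (nu : rat) (D : {linear {mpoly C[n]} -> {mpoly C[n]}}).
Hypothesis om_ge0 : forall i, 0 <= om i.
Hypothesis nu_gt0 : 0 < nu.
Hypothesis D_homog : forall k U, whomog om k U -> whomog om (k + nu) (D U).
Implicit Types (p : 'X_{1..n} -> {mpoly C[n]}).
Implicit Types (S : seq 'X_{1..n}).

(** Symmetric pairs with c_j = 1 and d_j = -1, the form in which splitting off
    a Jordan chain of D produces them. *)
Definition chain_pair (N : nat) (U V : nat -> {mpoly C[n]}) : Prop :=
  [/\ (1 <= N)%N,
      forall k, (1 <= k <= N)%N ->
        (exists a, whomog om a (U k)) /\ (exists b, whomog om b (V k)),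
      D (U N) = 0, D (V N) = 0
    & forall j, (1 <= j < N)%N -> D (U j) = U j.+1 /\ D (V j) = - V j.+1].

Definition pair_value N (U V : nat -> {mpoly C[n]}) (z : 'I_n -> C) : C :=
  \sum_(1 <= k < N.+1) (U k).@[z] * Num.conj (V (N - k + 1)%N).@[z].

(** The tensor sum_be p_be (x) conj z^be is homogeneous of degree kap and killed
    by D (x) 1 + 1 (x) conj D.  Splitting off a chain preserves this, whereas it
    may destroy Hermitian symmetry. *)
Definition skew_family (kap : rat) S p : Prop :=
  [/\ uniq S, forall be, be \notin S -> p be = 0,
      forall be, whomog om (kap - wdeg om be) (p be)
    & forall be, D (p be) = - \sum_(ga <- S) Num.conj (D 'X_[ga])@_be *: p ga].

Lemma iterD_homog k l U : whomog om k U -> whomog om (k + nu *+ l) (iter l D U).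
Proof.
move=> Uh; elim: l => [|l IH]; first by rewrite mulr0n addr0.
by rewrite mulrSr addrA; apply: D_homog.
Qed.

Arguments iterD_homog {k} l {U}.

Lemma iterD_sum l (I : Type) (r : seq I) (a : I -> C) (F : I -> {mpoly C[n]}) :
  iter l D (\sum_(i <- r) a i *: F i) = \sum_(i <- r) a i *: iter l D (F i).
Proof.
elim: l => // l IH; rewrite iterS IH linear_sum.
by apply: eq_bigr => i _; rewrite linearZ.
Qed.

Lemma iterDN l U : iter l D (- U) = - iter l D U.
Proof. by elim: l => // l IH; rewrite !iterS IH linearN. Qed.

Lemma iterD0 l : iter l D 0 = 0.
Proof. by elim: l => // l IH; rewrite iterS IH linear0. Qed.

(** Each application of D trades p_be for p_ga with ga of weight smaller by nu,
    and weights of monomials are nonnegative. *)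
Lemma skew_nilpotent kap S p : skew_family kap S p ->
  exists k, forall be, iter k D (p be) = 0.
Proof.
move=> [uS pS ph pD].
have nil k be : wdeg om be < nu *+ k -> iter k D (p be) = 0.
  elim: k be => [|k IH] be.
    by rewrite mulr0n ltNge wdeg_ge0.
  move=> lt; rewrite iterSr pD iterDN iterD_sum big1 ?oppr0 // => ga _.
  have [->|c0] := eqVneq (D 'X_[ga])@_be 0; first by rewrite rmorph0 scale0r.
  have wbe := whomog_coeff (D_homog (@whomogX _ om C ga)) c0.
  by rewrite IH ?scaler0 //; move: lt; rewrite wbe mulrSr ltrD2r.
(* A crude common bound for the weights of the monomials in S. *)
pose B := \sum_(be <- S) wdeg om be.
have B0 : 0 <= B / nu.
  by rewrite divr_ge0 ?(ltW nu_gt0) //; apply: sumr_ge0 => be _; apply: wdeg_ge0.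
exists (Num.bound (B / nu)) => be.
have [beS|/pS->] := boolP (be \in S); last first.
  exact: iterD0.
apply: nil; rewrite -mulr_natl.
apply: le_lt_trans (_ : B < _); last by rewrite -ltr_pdivrMr ?archi_boundP.
rewrite /B (big_rem _ beS) /= lerDl.
by apply: sumr_ge0 => ga _; apply: wdeg_ge0.
Qed.

(** Let N be least with D^N = 0 on all p_be, and e = p_be0 with D^(N-1) e <> 0.
    For phi the coefficient of a monomial of D^(N-1) e, normalised to be 1
    there,

      prj v = sum_(k < N) phi (D^(N-1-k) v) D^k e

    commutes with D on the p_be, so both prj and 1 - prj respect the recursion.
    The projected tensor is the pair value of U^k = D^(k-1) e and
    V^l = sum_be conj (phi (D^(l-1) p_be)) z^be.  Homogeneity gives
    phi (D^k e) = 0 for k < N-1, so prj e = e and the index be0 disappears from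
    the remainder. *)
Lemma split_chain kap S p : skew_family kap S p ->
  (exists2 be, be \in S & p be != 0) ->
  exists N U V p', [/\ chain_pair N U V, skew_family kap S p',
    (count (fun be => p' be != 0%R) S < count (fun be => p be != 0%R) S)%N
    & forall z, \sum_(be <- S) (p be).@[z] * Num.conj 'X_[be].@[z] =
        pair_value N U V z
        + \sum_(be <- S) (p' be).@[z] * Num.conj 'X_[be].@[z]].
Proof.
move=> psk [be1 be1S pbe1]; have [k0 nilk0] := skew_nilpotent psk.
case: (psk) => uS pS ph pD.
have exk : exists k, all (fun be => iter k D (p be) == 0) S.
  by exists k0; apply/allP => be _; rewrite nilk0.
case: (ex_minnP exk) => -[|N'] /allP nilN minN.
  by move: (nilN _ be1S) => /=; rewrite (negPf pbe1).
have {}nilN be : iter N'.+1 D (p be) = 0.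
  have [beS|/pS->] := boolP (be \in S); first exact/eqP/nilN.
  exact: iterD0.
have /allPn [be0 be0S eN0] : ~~ all (fun be => iter N' D (p be) == 0) S.
  by apply/negP => /minN; rewrite ltnn.
pose e := p be0; pose m0 := mlead (iter N' D e).
pose c := (iter N' D e)@_m0.
have c0 : c != 0 by rewrite -mcoeff_msupp mlead_supp.
have wm0 : wdeg om m0 = kap - wdeg om be0 + nu *+ N'.
  exact: whomog_coeff (iterD_homog N' (ph be0)) c0.
pose phi (v : {mpoly C[n]}) := v@_m0 / c.
have phi_sum (I : Type) (r : seq I) a F :
    phi (\sum_(i <- r) a i *: F i) = \sum_(i <- r) a i * phi (F i).
  rewrite /phi raddf_sum mulr_suml; apply: eq_bigr => i _.
  by rewrite /= mcoeffZ mulrA.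
have phiN v : phi (- v) = - phi v by rewrite /phi mcoeffN mulNr.
have phi_homog k v : whomog om k v -> phi v != 0 -> k = wdeg om m0.
  move=> vh; rewrite /phi => v0; symmetry; apply: whomog_coeff vh _.
  by apply: contraNneq v0 => ->; rewrite mul0r.
pose prj (v : {mpoly C[n]}) :=
  \sum_(k < N'.+1) phi (iter (N' - k) D v) *: iter k D e.
have prj_sum (I : Type) (r : seq I) a F :
    prj (\sum_(i <- r) a i *: F i) = \sum_(i <- r) a i *: prj (F i).
  rewrite /prj; under eq_bigr => k _ do rewrite iterD_sum phi_sum scaler_suml.
  rewrite exchange_big; apply: eq_bigr => i _; rewrite scaler_sumr.
  by apply: eq_bigr => k _; rewrite scalerA.
have prjN v : prj (- v) = - prj v.
  rewrite /prj -sumrN; apply: eq_bigr => k _.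
  by rewrite iterDN phiN scaleNr.
have prjD v : iter N'.+1 D v = 0 -> D (prj v) = prj (D v).
  move=> v0; rewrite /prj linear_sum big_ord_recr big_ord_recl /=.
  rewrite linearZ /= -iterS [iter _ D e]nilN scaler0 addr0 subn0.
  rewrite -iterSr v0 /phi mcoeff0 mul0r.
  rewrite scale0r add0r; apply: eq_bigr => k _.
  by rewrite linearZ -iterSr [bump 0 k]add1n subnSK.
pose U k := iter k.-1 D e.
pose V l := \sum_(be <- S) Num.conj (phi (iter l.-1 D (p be))) *: 'X_[be].
pose p' be := p be - prj (p be).
have mV l be : (V l)@_be = Num.conj (phi (iter l.-1 D (p be))).
  rewrite raddf_sum /=; have [beS|/[dup] beS /pS->] := boolP (be \in S).
    rewrite (big_rem _ beS) /= mcoeffZ mcoeffX eqxx mulr1 big_seq big1 ?addr0 //.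
    move=> ga; rewrite mem_rem_uniq // inE => /andP [/negPf ne _].
    by rewrite mcoeffZ mcoeffX ne mulr0.
  rewrite big_seq big1 => [|ga gaS]; last first.
    rewrite mcoeffZ mcoeffX; case: eqP => [gabe|]; last by rewrite mulr0.
    by rewrite -gabe gaS in beS.
  by rewrite iterD0 /phi mcoeff0 mul0r rmorph0.
have DV l : (0 < l)%N -> D (V l) = - V l.+1.
  move=> l0; apply/mpolyP => be; rewrite mcoeffN mV /=.
  rewrite -[X in iter X](prednK l0) iterSr pD iterDN phiN iterD_sum phi_sum.
  rewrite rmorphN opprK rmorph_sum /V linear_sum raddf_sum /=.
  by apply: eq_bigr => ga _; rewrite linearZ /= mcoeffZ [RHS]rmorphM /= conjCK mulrC.
exists N'.+1, U, V, p'; split.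
- split=> //.
  + move=> k _; split; first by eexists; apply: iterD_homog; apply: ph.
    exists (kap - wdeg om m0 + nu *+ k.-1).
    apply: coeff_whomog => be; rewrite mV conjC_eq0 => be0n.
    rewrite -(phi_homog _ _ (iterD_homog k.-1 (ph be)) be0n).
    by rewrite opprD addrA subrK subKr.
  + exact: (nilN be0).
  + rewrite DV //; apply/eqP; rewrite oppr_eq0; apply/eqP/mpolyP => be.
    by rewrite mV /= -iterS nilN /phi !mcoeff0 mul0r rmorph0.
  + move=> j /andP [j0 _]; rewrite DV //; split=> //.
    by rewrite /U /= -[X in _ = iter X _ _](prednK j0).
- split=> //.
  + move=> be /pS pbe; rewrite /p' pbe.
    have := prj_sum _ [::] (fun=> 0) (fun _ : nat => 0).
    by rewrite !big_nil => ->; rewrite subrr.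
  + move=> be; apply: whomogD => //; apply: whomogN; apply: whomog_sum => k _.
    have [->|pk0] := eqVneq (phi (iter (N' - k) D (p be))) 0.
      by rewrite scale0r; apply: whomog0.
    apply: whomogZ.
    have := phi_homog _ _ (iterD_homog (N' - k) (ph be)) pk0.
    rewrite wm0 => weq.
    have -> : kap - wdeg om be = kap - wdeg om be0 + nu *+ k.
      apply: (addIr (nu *+ (N' - k))).
      by rewrite weq -[RHS]addrA -mulrnDr subnKC // -ltnS.
    exact: iterD_homog.
  + move=> be; rewrite /p' linearB prjD ?nilN // pD prjN prj_sum -opprD.
    congr (- _); rewrite -sumrB; apply: eq_bigr => ga _.
    by rewrite scalerBr.
- have prj0 : prj 0 = 0.
    have := prj_sum _ [::] (fun=> 0) (fun _ : nat => 0).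
    by rewrite !big_nil.
  have p'0 : p' be0 = 0.
    rewrite /p' /prj big_ord_recl /= subn0 /phi -/c divff // scale1r big1.
      by rewrite addr0 subrr.
    move=> k _; rewrite [bump 0 k]add1n.
    have [->|pk0] := eqVneq ((iter (N' - k.+1) D (p be0))@_m0) 0.
      by rewrite mul0r scale0r.
    have := whomog_coeff (iterD_homog (N' - k.+1) (ph be0)) pk0.
    rewrite wm0 => /addrI /(mulrIn (lt0r_neq0 nu_gt0)) kN.
    by have := leq_subr k N'; rewrite -(subnSK (ltn_ord k)) -kN ltnn.
  have pbe0 : p be0 != 0.
    by apply: contraNneq eN0 => ->; rewrite iterD0.
  rewrite !(permP (perm_to_rem be0S)) /= p'0 eqxx pbe0.
  rewrite add0n add1n ltnS; apply: sub_count => be /=.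
  by apply: contraNneq => pbe; rewrite /p' pbe prj0 subrr.
- move=> z.
  have -> : pair_value N'.+1 U V z =
      \sum_(be <- S) (prj (p be)).@[z] * Num.conj 'X_[be].@[z].
    rewrite /pair_value big_add1 big_mkord.
    under [RHS]eq_bigr => be _ do rewrite /prj raddf_sum mulr_suml.
    rewrite exchange_big; apply: eq_bigr => k _.
    rewrite /V (raddf_sum (meval z)) (rmorph_sum Num.conj) mulr_sumr /=; apply: eq_bigr => be _.
    by rewrite /= !mevalZ rmorphM /= conjCK subSS addn1 /= mulrCA mulrA.
  rewrite -big_split; apply: eq_bigr => be _.
  by rewrite -[RHS]mulrDl -mevalD /p' addrC subrK.
Qed.

Lemma chain_decomposition_of_skew kap S p : skew_family kap S p ->
  exists M (N : nat -> nat) (U V : nat -> nat -> {mpoly C[n]}),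
    (forall j, chain_pair (N j) (U j) (V j)) /\
    forall z, \sum_(be <- S) (p be).@[z] * Num.conj 'X_[be].@[z] =
      \sum_(j < M) pair_value (N j) (U j) (V j) z.
Proof.
have [r] := ubnP (count (fun be => p be != 0) S).
elim: r p => // r IH p; rewrite ltnS => pr psk.
have [/hasP ex|/hasPn p0] := boolP (has (fun be => p be != 0) S).
  have [N [U [V [p' [UV p'sk p'p pE]]]]] := split_chain psk ex.
  have [M [N' [U' [V' [UV' p'E]]]]] := IH p' (leq_trans p'p pr) p'sk.
  exists M.+1, (fun j => if j is j'.+1 then N' j' else N),
    (fun j => if j is j'.+1 then U' j' else U),
    (fun j => if j is j'.+1 then V' j' else V); split; first by case.
  by move=> z; rewrite pE p'E big_ord_recl.
exists 0%N, (fun=> 1%N), (fun _ _ => 0), (fun _ _ => 0); split.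
  move=> _; split; rewrite ?linear0 //.
    by move=> k _; split; exists 0; apply: whomog0.
move=> z; rewrite big_ord0 big_seq big1 // => be /p0 /negPn /eqP ->.
by rewrite meval0 mul0r.
Qed.

End ChainDecomposition.

(** * Polynomial functions near the origin *)

Section Analysis.
Variable K : numFieldType.

Definition in_polydisc n (e : K) (x : 'rV[K]_n) : Prop := forall i, `|x 0 i| < e.

Lemma near0_polydiscP n (Phi : 'rV[K]_n -> Prop) :
  (\forall x \near (0 : 'rV[K]_n), Phi x) <->
  exists2 e : K, 0 < e & forall x, in_polydisc e x -> Phi x.
Proof.
split.
  move=> /nbhs_ballP [e /= e0 eP]; exists e => // x xe; apply: eP.
  by split=> // i j; rewrite /ball /= ord1 mxE sub0r normrN.
move=> [e e0 eP]; apply/nbhs_ballP; exists e => //= x [_ xe]; apply: eP => i.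
by have := xe 0 i; rewrite /ball /= mxE sub0r normrN.
Qed.

Definition mpoly_fun n (p : {mpoly K[n]}) (x : 'rV[K]_n) : K := p.@[fun i => x 0 i].

Lemma differentiable_mpoly_fun n (p : {mpoly K[n]}) (x : 'rV[K]_n) :
  differentiable (mpoly_fun p) x.
Proof.
elim/mpolyind: p => [|c m p _ _ IH].
  rewrite (_ : mpoly_fun 0 = cst 0) //; apply/funext => y; exact: meval0.
rewrite (_ : mpoly_fun _ = (c *: mpoly_fun 'X_[m]) + mpoly_fun p); last first.
  by apply/funext => y; rewrite /mpoly_fun mevalD mevalZ.
apply: differentiableD => //; apply: differentiableZ.
rewrite mpolyXE_id.
elim/big_ind: _ => [|p1 p2 d1 d2|i _].
- by rewrite (_ : mpoly_fun 1 = cst 1) //; apply/funext => y; exact: meval1.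
- rewrite (_ : mpoly_fun _ = mpoly_fun p1 * mpoly_fun p2); first exact: differentiableM.
  by apply/funext => y; rewrite /mpoly_fun mevalM.
elim: (m i) => [|k IHk].
  by rewrite expr0 (_ : mpoly_fun 1 = cst 1) //; apply/funext => y; exact: meval1.
pose f : 'rV[K]_n -> K := fun y => y 0 i.
rewrite exprS (_ : mpoly_fun _ = f * mpoly_fun ('X_i ^+ k)).
  by apply: differentiableM => //; apply: differentiable_coord.
by apply/funext => y; rewrite /mpoly_fun mevalM mevalXU.
Qed.

Lemma derive_mpoly_fun n (p : {mpoly K[n]}) (x : 'rV[K]_n) i :
  'D_(delta_mx 0 i) (mpoly_fun p) x = mpoly_fun p^`M(i) x.
Proof.
have dX j : 'D_(delta_mx 0 i) (fun y : 'rV[K]_n => y 0 j) x = (j == i)%:R.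
  rewrite /derive; apply: cvg_lim => //; apply: cvg_near_cst; near=> h.
  have h0 : h != 0 by near: h; exact: nbhs_dnbhs_neq.
  rewrite /= !mxE addrK eqxx /=; change (h^-1 * (h * (j == i)%:R) = (j == i)%:R).
  by rewrite mulKf.
have dM (p1 p2 : {mpoly K[n]}) :
    'D_(delta_mx 0 i) (mpoly_fun p1) x = mpoly_fun p1^`M(i) x ->
    'D_(delta_mx 0 i) (mpoly_fun p2) x = mpoly_fun p2^`M(i) x ->
    'D_(delta_mx 0 i) (mpoly_fun (p1 * p2)) x = mpoly_fun (p1 * p2)^`M(i) x.
  move=> d1 d2; rewrite (_ : mpoly_fun (p1 * p2) = mpoly_fun p1 * mpoly_fun p2); last first.
    by apply/funext => y; rewrite /mpoly_fun mevalM.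
  rewrite deriveM; try exact/diff_derivable/differentiable_mpoly_fun.
  rewrite d1 d2 mderivM /mpoly_fun mevalD !mevalM addrC; congr (_ + _).
  by rewrite mulrC.
have d1 : 'D_(delta_mx 0 i) (mpoly_fun 1) x = mpoly_fun (1 : {mpoly K[n]})^`M(i) x.
  rewrite (_ : mpoly_fun 1 = cst 1); last by apply/funext => y; exact: meval1.
  by rewrite derive_cst -mpolyC1 mderivC /mpoly_fun meval0.
elim/mpolyind: p => [|c m p _ _ IH].
  rewrite (_ : mpoly_fun 0 = cst 0); last by apply/funext => y; exact: meval0.
  by rewrite derive_cst mderiv0 /mpoly_fun meval0.
rewrite (_ : mpoly_fun _ = (c *: mpoly_fun 'X_[m]) + mpoly_fun p); last first.
  by apply/funext => y; rewrite /mpoly_fun mevalD mevalZ.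
rewrite deriveD; try exact/diff_derivable/differentiable_mpoly_fun; last first.
  exact/diff_derivable/differentiableZ/differentiable_mpoly_fun.
rewrite deriveZ; last exact/diff_derivable/differentiable_mpoly_fun.
rewrite IH mderivD mderivZ /mpoly_fun mevalD mevalZ; congr (c * _ + _).
rewrite mpolyXE_id; elim/big_ind: _ => // j _.
elim: (m j) => [|k IHk]; first by rewrite expr0.
rewrite exprS; apply: dM => //.
rewrite (_ : mpoly_fun 'X_j = fun y => y 0 j); last first.
  by apply/funext => y; rewrite /mpoly_fun mevalXU.
rewrite dX mderivX /mpoly_fun mevalZ mnm1E eq_sym; case: eqVneq => [->|_].
  rewrite mul1r (_ : (U_(j) - U_(j))%MM = 0%MM) ?mpolyX0 ?meval1 //.
  by apply/mnmP => l; rewrite mnmBE mnm0E subnn.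
by rewrite mul0r.
Unshelve. all: by end_near. Qed.

Lemma differentiable_row n k (F : 'I_k -> {mpoly K[n]}) (x : 'rV[K]_n) :
  differentiable (fun y : 'rV[K]_n => \row_i mpoly_fun (F i) y) x.
Proof.
rewrite (_ : (fun y : 'rV[K]_n => _) =
    \sum_i fun y => mpoly_fun (F i) y *: (delta_mx 0 i : 'rV[K]_k)).
  by apply: differentiable_sum => i; apply: differentiableZl; apply: differentiable_mpoly_fun.
apply/funext => y; rewrite fct_sumE; apply/rowP => j; rewrite mxE summxE.
rewrite (bigD1 j) //= big1 ?addr0.
  by rewrite !mxE !eqxx mulr1.
by move=> i ij; rewrite !mxE eq_sym (negPf ij) mulr0.
Qed.

(** Coordinates of matrices are continuous, so limits of difference quotients
    can be taken entrywise. *)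
Lemma derive_row n k (F : 'I_k -> {mpoly K[n]}) (x v : 'rV[K]_n) j :
  ('D_v (fun y : 'rV[K]_n => \row_i mpoly_fun (F i) y) x) 0 j = 'D_v (mpoly_fun (F j)) x.
Proof.
symmetry; apply: cvg_lim => //.
pose G (y : 'rV[K]_n) : 'rV[K]_k := \row_i mpoly_fun (F i) y.
have /cvg_ex [l Gl] : derivable G x v by apply/diff_derivable/differentiable_row.
rewrite (_ : 'D_v _ x = l); last exact: cvg_lim Gl.
have Glj := cvg_comp _ _ Gl (@coord_continuous _ _ _ 0 j l).
apply: cvg_trans Glj; apply: near_eq_cvg; near=> h.
by rewrite /= !mxE.
Unshelve. all: by end_near. Qed.

Lemma mpoly_fun_small n (p : {mpoly K[n]}) (e : K) : 0 < e -> mpoly_fun p 0 = 0 ->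
  exists2 d : K, 0 < d & forall x, in_polydisc d x -> `|mpoly_fun p x| < e.
Proof.
move=> e0 p0; have := differentiable_continuous (differentiable_mpoly_fun p 0).
move=> /cvgrPdist_lt /(_ e e0) /near0_polydiscP [d d0 dP]; exists d => // x /dP.
by rewrite p0 sub0r normrN.
Qed.

End Analysis.


(** * Derivations acting on Hermitian polynomials *)

Section VectorFields.
Variables (K : comNzRingType) (n : nat) (f : 'I_n -> {mpoly K[n]}).

Definition vderiv (U : {mpoly K[n]}) : {mpoly K[n]} :=
  \sum_j f j * U^`M(j).

Lemma vderiv_is_linear : linear vderiv.
Proof.
move=> c U V; rewrite /vderiv scaler_sumr -big_split; apply: eq_bigr => j _.
by rewrite linearP mulrDr scalerAr.
Qed.

HB.instance Definition _ :=
  GRing.isLinear.Build K {mpoly K[n]} {mpoly K[n]} _ vderiv vderiv_is_linear.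

Lemma vderiv_homog (om : 'I_n -> rat) nu k U :
  (forall j, whomog om (nu + om j) (f j)) ->
  whomog om k U -> whomog om (k + nu) (vderiv U).
Proof.
move=> fh Uh; apply: whomog_sum => j _.
have -> : k + nu = (nu + om j) + (k - om j) by rewrite addrC addrACA subrr addr0.
by apply: whomogM => //; apply: whomog_deriv.
Qed.

End VectorFields.

Lemma mpolyE_on (K : nzRingType) n (T : seq 'X_{1..n}) (q : {mpoly K[n]}) :
  uniq T -> (forall m, m \notin T -> q@_m = 0) ->
  q = \sum_(m <- T) q@_m *: 'X_[m].
Proof.
move=> uT q0; apply/mpolyP => m; rewrite raddf_sum /=.
have [mT|mT] := boolP (m \in T).
  rewrite (big_rem _ mT) /= mcoeffZ mcoeffX eqxx mulr1.
  rewrite big_seq big1 ?addr0 // => m'; rewrite mem_rem_uniq //.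
  by rewrite inE mcoeffZ mcoeffX => /andP [/negPf -> _]; rewrite mulr0.
rewrite q0 // big_seq big1 // => m' m'T.
rewrite mcoeffZ mcoeffX; case: eqP => [mm|]; last by rewrite mulr0.
by rewrite -mm m'T in mT.
Qed.

Section HermitianPolynomials.
Variables (C : numClosedFieldType) (n : nat).
Variables (P : {mpoly C[(n + n)%N]}) (f : 'I_n -> {mpoly C[n]}).

Local Notation p be := (slice be P).
Local Notation S := (slices P).

Lemma meval_herm_slices z :
  P.@[conj_pair z] = \sum_(be <- S) (p be).@[z] * Num.conj 'X_[be].@[z].
Proof.
rewrite (meval_slices _ (undup_uniq _) (@slice_out _ _ _ P)).
apply: eq_bigr => be _; congr (_ * _).
  by apply: meval_eq => i; rewrite conj_pairl.
rewrite mevalX rmorph_prod; apply: eq_bigr => i _.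
by rewrite conj_pairr rmorphXn.
Qed.

(** The polynomial YP for the rigid field Y with components f. *)
Definition field_act : {mpoly C[(n + n)%N]} :=
  \sum_(be <- S) herm (vderiv f (p be)) 'X_[be].

Lemma slice_field_act be : slice be field_act = vderiv f (p be).
Proof.
apply/mpolyP => al; rewrite mcoeff_slice raddf_sum /=.
have [beS|beS] := boolP (be \in S).
  rewrite (big_rem _ beS) /= mcoeff_herm mcoeffX eqxx rmorph1 mulr1.
  rewrite big_seq big1 ?addr0 // => ga; rewrite mem_rem_uniq ?undup_uniq //.
  by rewrite inE mcoeff_herm mcoeffX => /andP [/negPf -> _]; rewrite rmorph0 mulr0.
rewrite (slice_out beS) linear0 mcoeff0 big_seq big1 // => ga gaS.
rewrite mcoeff_herm mcoeffX; case: eqP => [gb|]; last by rewrite rmorph0 mulr0.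
by rewrite -gb gaS in beS.
Qed.

Lemma meval_field_act z :
  field_act.@[conj_pair z] =
  \sum_j (f j).@[z] * P^`M(lshift n j).@[conj_pair z].
Proof.
rewrite raddf_sum /=; under eq_bigr => be _ do rewrite meval_herm.
have dP j : P^`M(lshift n j).@[conj_pair z] =
    \sum_(be <- S) (p be)^`M(j).@[z] * Num.conj 'X_[be].@[z].
  rewrite (meval_slices _ (undup_uniq [seq mright m | m <- msupp P])).
    apply: eq_bigr => be _; rewrite slice_deriv; congr (_ * _).
      by apply: meval_eq => i; rewrite conj_pairl.
    rewrite mevalX rmorph_prod; apply: eq_bigr => i _.
    by rewrite conj_pairr rmorphXn.
  by move=> be beS; rewrite slice_deriv (slice_out beS) linear0.
under [RHS]eq_bigr => j _ do rewrite dP mulr_sumr.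
rewrite exchange_big; apply: eq_bigr => be _.
rewrite /vderiv (raddf_sum (meval z)) mulr_suml; apply: eq_bigr => j _.
by rewrite /= mevalM mulrA.
Qed.

Lemma meval_field_act_skew z :
  (forall al be, (vderiv f (p be))@_al + Num.conj (vderiv f (p al))@_be = 0) ->
  field_act.@[conj_pair z] + Num.conj field_act.@[conj_pair z] = 0.
Proof.
move=> skew; rewrite -meval_conj_swap -mevalD.
suff -> : field_act + conj_swap field_act = 0 by rewrite meval0.
apply/mpolyP => m; rewrite -(mcatK m) mcoeffD mcoeff_conj_swap mcoeff0.
by rewrite -!mcoeff_slice !slice_field_act skew.
Qed.

Hypothesis P_herm : conj_swap P = P.

Lemma slice_herm al be : (p be)@_al = Num.conj (p al)@_be.
Proof. by rewrite !mcoeff_slice -[in LHS]P_herm mcoeff_conj_swap. Qed.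

(** Expand p_al in monomials: (D p_al)_be = sum_ga (p_al)_ga (D z^ga)_be, and
    Hermitian symmetry turns conj (p_al)_ga into (p_ga)_al. *)
Lemma slice_recursion :
  (forall al be, (vderiv f (p be))@_al + Num.conj (vderiv f (p al))@_be = 0) ->
  forall be, vderiv f (p be) =
    - \sum_(ga <- S) Num.conj (vderiv f 'X_[ga])@_be *: p ga.
Proof.
move=> skew be; apply/mpolyP => al; rewrite mcoeffN [in RHS]raddf_sum /=.
apply/eqP; rewrite -addr_eq0 -[X in _ == X](skew al be); apply/eqP.
congr (_ + _).
have pE : p al = \sum_(ga <- S) (p al)@_ga *: 'X_[ga].
  apply: mpolyE_on; first exact: undup_uniq.
  by move=> ga gaS; rewrite slice_herm (slice_out gaS) mcoeff0 rmorph0.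
rewrite pE (linear_sum (vderiv f)) (raddf_sum (mcoeff be)) (rmorph_sum Num.conj); apply: eq_bigr => ga _.
by rewrite /= mcoeffZ [vderiv f (_ *: _)]linearZ /= mcoeffZ [RHS]rmorphM /= -slice_herm mulrC.
Qed.

End HermitianPolynomials.

(** The k-th term of the first sum and the (k+1)-st of the second carry the same
    product u_(k+1) conj v_(N-k+1), with opposite coefficients. *)
Lemma chain_telescope (C : numClosedFieldType) (N : nat) (u v : nat -> C)
    (Du Dv : nat -> C) (c d : nat -> C) :
  Du N = 0 -> Dv N = 0 ->
  (forall j, (1 <= j < N)%N -> [/\ Du j = c j * u j.+1, Dv j = d j * v j.+1
     & c j = - Num.conj (d (N - j)%N)]) ->
  \sum_(1 <= k < N.+1) (Du k * Num.conj (v (N - k + 1)%N)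
                        + u k * Num.conj (Dv (N - k + 1)%N)) = 0.
Proof.
case: N => [|N] DuN DvN uv; first by rewrite big_geq.
rewrite big_split /= big_nat_recr //= DuN mul0r addr0.
rewrite [X in _ + X]big_nat_recl //= subn1 addn1 DvN rmorph0 mulr0 add0r.
rewrite -big_split big_nat big1 //= => k kN.
have [-> _ ->] := uv k kN; have /andP [k1 {}kN] := kN.
have lN : (1 <= N.+1 - k < N.+1)%N by rewrite subn_gt0 kN ltn_subrL k1.
have [_ DvE _] := uv _ lN.
rewrite (_ : N.+1 - k.+1 + 1 = N.+1 - k)%N; last by rewrite subSS addn1 -subSn.
by rewrite DvE addn1 rmorphM /= !mulNr -mulrA mulrCA addNr.
Qed.

(** * Coordinates of the model hypersurface *)

Section Germs.
Variable R : realType.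
Local Notation C := R[i].
Local Notation C2 := 'rV[C]_2.
Local Notation C3 := 'rV[C]_3.

Lemma Re_eq0 (x : C) : (complex.Re x = 0) <-> (x + Num.conj x = 0).
Proof.
case: x => a b; split => /= [->|[] /eqP].
  by apply/eqP; rewrite eq_complex /= addr0 subrr eqxx.
by rewrite -mulr2n mulrn_eq0 /= => /eqP.
Qed.

Lemma Im_eq0 (x : C) : complex.Im x = 0 -> Num.conj x = x.
Proof. by case: x => a b /= ->; apply/eqP; rewrite eq_complex /= oppr0 !eqxx. Qed.

Lemma Im_mulCi (x : C) : complex.Im ('i * x) = complex.Re x.
Proof. by case: x => a b; rewrite /= mul0r mul1r add0r. Qed.

Lemma evzzE (P : {mpoly C[4]}) (z : C2) :
  evzz P z = (P : {mpoly C[(2 + 2)%N]}).@[conj_pair (fun i => z 0 i)].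
Proof.
apply: meval_eq => k; rewrite -(@splitK 2 2 k); case: (fintype.split _) => j /=.
  by rewrite conj_pairl; exact: (@row_mxEl _ 1 2 2).
by rewrite conj_pairr; apply: etrans (@row_mxEr _ 1 2 2 _ _ _ _) _; rewrite mxE.
Qed.

Definition pt (z : C2) (w : C) : C3 := @row_mx C 1 2 1 z (const_mx w).

Lemma ord_maxE : (ord_max : 'I_3) = rshift 2 (ord0 : 'I_1).
Proof. exact: val_inj. Qed.

Lemma ptl z w (j : 'I_2) : pt z w 0 (lshift 1 j) = z 0 j.
Proof. exact: (@row_mxEl _ 1 2 1). Qed.

Lemma ptr z w : pt z w 0 (rshift 2 (ord0 : 'I_1)) = w.
Proof. by apply: etrans (@row_mxEr _ 1 2 1 _ _ _ _) _; rewrite mxE. Qed.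

Lemma zpart_pt z w : zpart (pt z w) = z.
Proof. exact: row_mxKl. Qed.

Lemma wpart_pt z w : wpart (pt z w) = w.
Proof. by rewrite /wpart ord_maxE ptr. Qed.

Lemma zpartE (x : C3) (j : 'I_2) : zpart x 0 j = x 0 (lshift 1 j).
Proof. by rewrite mxE. Qed.

Lemma wpartE (x : C3) : wpart x = x 0 (rshift 2 ord0).
Proof. by rewrite /wpart ord_maxE. Qed.

Lemma in_polydisc_pt (e : C) z w : in_polydisc e z -> `|w| < e -> in_polydisc e (pt z w).
Proof.
move=> ze we i; rewrite -(@splitK 2 1 i); case: (fintype.split _) => j /=.
  by rewrite ptl.
by rewrite ord1 ptr.
Qed.

Lemma conj_pair_small (Q : {mpoly C[(2 + 2)%N]}) (e : C) : 0 < e ->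
  (forall z : C2, in_polydisc e z -> evzz (Q : {mpoly C[4]}) z = 0) -> Q = 0.
Proof.
move=> e0 Q0; apply: (conj_pair_eq0 e0) => z ze.
rewrite -(Q0 (\row_i z i)) => [|i]; last by rewrite mxE.
rewrite evzzE; apply: meval_eq => k; rewrite /conj_pair.
by case: fintype.split => j; rewrite mxE.
Qed.

Lemma ev_eq0_near n (p : {mpoly C[n]}) :
  (\forall x \near (0 : 'rV[C]_n), ev p x = 0) -> p = 0.
Proof.
move=> /near0_polydiscP [e e0 p0]; apply: (mpoly_eq0_near e0) => x xe.
rewrite -(p0 (\row_i x i)) => [|i]; last by rewrite mxE.
by apply: meval_eq => i; rewrite mxE.
Qed.

Section Model.
Variables (mu : weight) (P : {mpoly C[4]}).
Hypothesis mu_gt0 : finite_multitype_weights mu.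
Hypothesis P_real : real_valued P.
Hypothesis P_noplh : no_pluriharmonic P.
Hypothesis P_homog : whomog (wt_zz mu) 1 P.

Local Notation p be := (@slice C 2 2 be P).
Local Notation S := (@slices C 2 2 P).

Lemma wt_gt0 j : 0 < wt mu j.
Proof. by rewrite /wt; case: mu_gt0; case: ifP. Qed.

Lemma wdeg_zz (al be : 'X_{1..2}) :
  wdeg (wt_zz mu) (@mcat 2 2 al be) = wdeg (wt mu) al + wdeg (wt mu) be.
Proof.
rewrite (@wdeg_mcat 2 2); congr (_ + _); apply: eq_wdeg => i; rewrite /wt_zz.
  by rewrite -[lshift 2 i]/(unsplit (inl i)) unsplitK.
by rewrite -[rshift 2 i]/(unsplit (inr i)) unsplitK.
Qed.

Lemma wdeg_zw (al : 'X_{1..2}) (l : 'X_{1..1}) :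
  wdeg (wt_zw mu) (@mcat 2 1 al l) = wdeg (wt mu) al + (l ord0)%:R.
Proof.
rewrite (@wdeg_mcat 2 1); congr (_ + _).
  by apply: eq_wdeg => i; rewrite /wt_zw -[lshift 1 i]/(unsplit (inl i)) unsplitK.
rewrite /wdeg big_ord1 /wt_zw -[rshift 2 ord0]/(unsplit (inr ord0)) unsplitK.
by rewrite mulr1.
Qed.

Lemma wt_zwl (j : 'I_2) : wt_zw mu (lshift 1 j) = wt mu j.
Proof. by rewrite /wt_zw -[lshift 1 j]/(unsplit (inl j)) unsplitK. Qed.

Lemma P_conj_swap : @conj_swap C 2 P = P.
Proof.
apply/eqP; rewrite -subr_eq0; apply/eqP.
apply: (@conj_pair_small _ 1) => // z _.
rewrite evzzE mevalB meval_conj_swap -!evzzE.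
by rewrite (Im_eq0 (P_real z)) subrr.
Qed.

Lemma slice_homog be : whomog (wt mu) (1 - wdeg (wt mu) be) (p be).
Proof.
apply: coeff_whomog => al; rewrite mcoeff_slice => /(whomog_coeff P_homog).
by rewrite wdeg_zz => <-; rewrite addrK.
Qed.

Lemma slice_at0 : p 0%MM = 0.
Proof.
apply/mpolyP => al; rewrite mcoeff_slice mcoeff0; apply/eqP.
apply: contraT; rewrite -mcoeff_msupp => /P_noplh [_ [j]].
by rewrite (@mcatr 2 2) mnm0E.
Qed.

Lemma mcoeff0_slice be : (p be)@_0%MM = 0.
Proof. by rewrite (slice_herm P_conj_swap) slice_at0 mcoeff0 rmorph0. Qed.

(** P has no monomial zbar^be without a factor from z, and weights are
    positive. *)
Lemma slice_wdeg_lt1 be : p be != 0 -> wdeg (wt mu) be < 1.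
Proof.
move=> pbe; have := slice_homog (mlead_supp pbe).
have al0 : mlead (p be) != 0%MM.
  by apply: contraTneq (mlead_supp pbe) => ->; rewrite mcoeff_msupp mcoeff0_slice eqxx.
by have := wdeg_gt0 wt_gt0 al0 => + e; rewrite e subr_gt0.
Qed.

Lemma act_rho_rigid (X : C3 -> C3) (f : 'I_2 -> {mpoly C[2]}) (x : C3) :
  (forall j, zpart (X x) 0 j = ev (f j) (zpart x)) ->
  act_rho P X x = wpart (X x) / (2 * 'i) -
    evzz (@field_act C 2 P f : {mpoly C[4]}) (zpart x).
Proof.
move=> Xf; rewrite /act_rho evzzE meval_field_act; congr (_ - _).
by apply: eq_bigr => j _; rewrite Xf -evzzE.
Qed.

(** The term g contributes only to coefficients with al = 0 or be = 0.  There,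
    p_0 = 0 because P has no pluriharmonic terms, and (D p_be)_0 = 0 because
    the f_j vanish at 0; so the relation holds at those indices too. *)
Lemma skew_of_tangent (f : 'I_2 -> {mpoly C[2]}) (g : {mpoly C[2]}) (e : C) :
  0 < e -> (forall j, (f j)@_0%MM = 0) ->
  (forall z : C2, in_polydisc e z -> complex.Re (ev g z / (2 * 'i) -
     evzz (@field_act C 2 P f : {mpoly C[4]}) z) = 0) ->
  forall al be, (vderiv f (p be))@_al + Num.conj (vderiv f (p al))@_be = 0.
Proof.
move=> e0 f0 tan al be.
pose Q := herm ((2 * 'i)^-1 *: g) 1 - @field_act C 2 P f.
have Q0 : Q + conj_swap Q = 0.
  apply: (conj_pair_small e0) => z ze.
  rewrite evzzE mevalD meval_conj_swap; apply/Re_eq0; rewrite -[RHS](tan z ze).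
  by rewrite mevalB meval_herm mevalZ meval1 rmorph1 mulr1 mulrC -evzzE.
have Dp0 ga : (vderiv f (p ga))@_0%MM = 0.
  rewrite /vderiv (raddf_sum (mcoeff _)) big1 // => j _.
  by rewrite /= (rmorphM (mcoeff 0%MM)) /= f0 mul0r.
have Dp1 ga : (vderiv f (p 0%MM))@_ga = 0 by rewrite slice_at0 linear0 mcoeff0.
have [->|al0] := eqVneq al 0%MM; first by rewrite Dp0 Dp1 rmorph0 addr0.
have [->|be0] := eqVneq be 0%MM; first by rewrite Dp0 Dp1 rmorph0 addr0.
have /mpolyP /(_ (mcat al be)) := Q0.
rewrite mcoeffD mcoeff_conj_swap mcoeff0 !mcoeffB !mcoeff_herm !mcoeff1.
rewrite (negPf al0) (negPf be0) rmorph0 !mulr0 !sub0r rmorphN -opprD.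
rewrite -!mcoeff_slice !slice_field_act => /eqP; rewrite oppr_eq0 => /eqP //.
Qed.

End Model.
End Germs.

(** * Polynomial vector fields and rigidity *)

Section Fields.
Variable R : realType.
Local Notation C := R[i].
Local Notation C2 := 'rV[C]_2.
Local Notation C3 := 'rV[C]_3.
Local Notation wslice l F := (@slice C 2 1 l F).

Definition poly_field (F : 'I_3 -> {mpoly C[3]}) (x : C3) : C3 :=
  \row_i ev (F i) x.

(** In characteristic 0, independence of w means that no positive power of w
    occurs. *)
Lemma slice_eq0_of_deriv (F : {mpoly C[3]}) : F^`M(ord_max) = 0 ->
  forall l, l != 0%MM -> wslice l F = 0.
Proof.
move=> F0 l ln0; apply/mpolyP => al; rewrite mcoeff_slice mcoeff0.
set m := mcat al l; have lm : (U_(ord_max) <= m)%MM.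
  rewrite lep1mP ord_maxE (@mcatr 2 1); apply: contraNneq ln0 => l0.
  by apply/eqP/mnmP => i; rewrite ord1 l0 mnm0E.
have := mcoeff_deriv ord_max (m - U_(ord_max))%MM F.
rewrite F0 mcoeff0 submK // => /esym/eqP; rewrite mulrn_eq0 /=.
by move/eqP.
Qed.

Lemma ev_slices (F : {mpoly C[3]}) (L : seq 'X_{1..1}) (x : C3) : uniq L ->
  (forall l, l \notin L -> wslice l F = 0) ->
  ev F x = \sum_(l <- L) ev (wslice l F) (zpart x) * wpart x ^+ l ord0.
Proof.
move=> uL L0; rewrite /ev (@meval_slices C 2 1 F L) //.
apply: eq_bigr => l _; rewrite big_ord1 wpartE; congr (_ * _).
by apply: meval_eq => i; rewrite zpartE.
Qed.

Lemma ev_rigid (F : {mpoly C[3]}) x :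
  (forall l, l != 0%MM -> wslice l F = 0) ->
  ev F x = ev (wslice 0%MM F) (zpart x).
Proof.
move=> F0; rewrite (@ev_slices F [:: 0%MM]) //.
  by rewrite big_seq1 mnm0E expr0 mulr1.
by move=> l; rewrite inE; apply: F0.
Qed.

Lemma ev_tensor (u : {mpoly C[2]}) (v : {mpoly C[1]}) (x : C3) :
  ev (@tensor C 2 1 u v) x = ev u (zpart x) * v.@[fun=> wpart x].
Proof.
rewrite /ev (@meval_tensor C 2 1); congr (_ * _); apply: meval_eq => i.
  by rewrite zpartE.
by rewrite ord1 wpartE.
Qed.

(** The bracket with d/dw is the derivative in w. *)
Lemma rigid_of_bracket (X : C3 -> C3) (F : 'I_3 -> {mpoly C[3]}) :
  (\forall x \near (0 : C3), forall i, X x 0 i = ev (F i) x) ->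
  (\forall x \near (0 : C3), lie_bracket (@d_w R) X x = 0) ->
  forall k, (F k)^`M(ord_max) = 0.
Proof.
move=> XF br k; apply: ev_eq0_near.
pose G := poly_field F.
have XG : \forall x \near (0 : C3), X x = G x.
  by apply: filterS XF => x Xx; apply/rowP => i; rewrite Xx mxE.
near=> x.
have brx : lie_bracket (@d_w R) X x = 0 by near: x.
have XGx : \forall y \near x, X y = G y by near: x; exact: (near_join XG).
rewrite -[ev _ x](@derive_mpoly_fun C 3 (F k) x ord_max) -(derive_row F).
move: brx; rewrite /lie_bracket (_ : 'D_(X x) _ x = 0); last exact: derive_cst.
rewrite subr0 (near_eq_derive _ XGx) => /matrixP /(_ 0 k).
by rewrite mxE.
Unshelve. all: by end_near. Qed.

(** The components, as polynomials in (z, w), of f_1 d/dz_1 + f_2 d/dz_2. *)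
Definition rigid_field (f : 'I_2 -> {mpoly C[2]}) (i : 'I_3) : {mpoly C[3]} :=
  match @fintype.split 2 1 i with
  | inl j => @tensor C 2 1 (f j) 1 | inr _ => 0 end.

Lemma rigid_fieldl f (j : 'I_2) : rigid_field f (lshift 1 j) = @tensor C 2 1 (f j) 1.
Proof. by rewrite /rigid_field -[lshift 1 j]/(unsplit (inl j)) unsplitK. Qed.

Lemma rigid_fieldr f (j : 'I_1) : rigid_field f (rshift 2 j) = 0.
Proof. by rewrite /rigid_field -[rshift 2 j]/(unsplit (inr j)) unsplitK. Qed.

Lemma holomorphic_poly_field F : holomorphic0 (poly_field F).
Proof. by near=> x; apply: (differentiable_row F). Unshelve. all: by end_near. Qed.

Lemma zpart_rigid_field f x j :
  zpart (poly_field (rigid_field f) x) 0 j = ev (f j) (zpart x).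
Proof. by rewrite zpartE mxE rigid_fieldl ev_tensor meval1 mulr1. Qed.

Lemma wpart_rigid_field f x : wpart (poly_field (rigid_field f) x) = 0.
Proof. by rewrite wpartE mxE rigid_fieldr /ev meval0. Qed.

Lemma rigid_field_bracket f x :
  lie_bracket (@d_w R) (poly_field (rigid_field f)) x = 0.
Proof.
rewrite /lie_bracket (_ : 'D_(poly_field _ x) _ x = 0); last exact: derive_cst.
rewrite subr0; apply: cvg_lim => //; apply: cvg_near_cst; near=> h.
rewrite /= (_ : poly_field _ (_ + _) = poly_field (rigid_field f) x).
  by rewrite subrr scaler0.
apply/rowP => i; rewrite !mxE -(@splitK 2 1 i).
case: (fintype.split _) => j /=; last by rewrite rigid_fieldr /ev !meval0.
rewrite rigid_fieldl !ev_tensor !meval1; congr (ev _ _ * _); apply/rowP => k.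
have kw : (lshift 1 k == ord_max :> 'I_3) = false by rewrite ord_maxE; exact: (@eq_lrshift 2 1).
by rewrite !zpartE !mxE kw andbF mulr0 add0r.
Unshelve. all: by end_near. Qed.

End Fields.

(** * From generalized rotations to chains *)

Section MainTheorem.
Variable R : realType.
Local Notation C := R[i].
Local Notation C2 := 'rV[C]_2.
Local Notation C3 := 'rV[C]_3.
Local Notation wslice l F := (@slice C 2 1 l F).

Section Model.
Variables (mu : weight) (P : {mpoly C[4]}).
Hypothesis mu_gt0 : finite_multitype_weights mu.
Hypothesis P_real : real_valued P.
Hypothesis P_noplh : no_pluriharmonic P.
Hypothesis P_homog : whomog (wt_zz mu) 1 P.

Local Notation p be := (@slice C 2 2 be P).
Local Notation S := (@slices C 2 2 P).

Lemma wslice_homog nu (F : 'I_3 -> {mpoly C[3]}) (j : 'I_2) :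
  (forall i, whomog (wt_zw mu) (nu + wt_zw mu i) (F i)) ->
  whomog (wt mu) (nu + wt mu j) (wslice 0%MM (F (lshift 1 j))).
Proof.
move=> Fh; apply: coeff_whomog => al; rewrite mcoeff_slice.
by move=> /(whomog_coeff (Fh _)); rewrite wdeg_zw mnm0E addr0 wt_zwl.
Qed.

Lemma rigid_field_homog nu (f : 'I_2 -> {mpoly C[2]}) :
  (forall j, whomog (wt mu) (nu + wt mu j) (f j)) ->
  forall i, whomog (wt_zw mu) (nu + wt_zw mu i) (rigid_field f i).
Proof.
move=> fh i; rewrite -(@splitK 2 1 i); case: (fintype.split _) => j /=.
  rewrite rigid_fieldl wt_zwl; apply: coeff_whomog => m.
  rewrite -(@mcatK 2 1 m) (@mcoeff_tensor C 2 1) mcoeff1 => c0.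
  move: c0; rewrite wdeg_zw; case: (@mright 2 1 m =P 0%MM) => [->|_]; last by rewrite mulr0 eqxx.
  by rewrite mulr1 mnm0E addr0 => /(whomog_coeff (fh j)).
by rewrite rigid_fieldr; apply: whomog0.
Qed.

Lemma mcoeff0_homog nu (f : 'I_2 -> {mpoly C[2]}) : 0 < nu ->
  (forall j, whomog (wt mu) (nu + wt mu j) (f j)) ->
  forall j, (f j)@_0%MM = 0.
Proof.
move=> nu0 fh j; apply/eqP; apply: contraT => /(whomog_coeff (fh j)).
rewrite /wdeg big1 => [|i _]; last by rewrite mnm0E mul0r.
by move/eqP; rewrite eq_sym gt_eqF // addr_gt0 // wt_gt0.
Qed.

(** The points (z, iP(z)) lie on the model and tend to 0 with z, as P(0) = 0.
    For rigid fields they carry all the information of the tangency. *)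
Lemma near_model_graph (Phi : C3 -> Prop) :
  (\forall x \near (0 : C3), model P x -> Phi x) ->
  exists2 e : C, 0 < e & forall z : C2, in_polydisc e z -> Phi (pt z ('i * evzz P z)).
Proof.
move=> /near0_polydiscP [e e0 Pe].
have P0 : mpoly_fun P 0 = 0.
  rewrite /mpoly_fun mevalE big_seq big1 // => m /P_noplh [[j mj] _].
  by rewrite (bigD1 (lshift 2 j)) //= mxE expr0n (negPf mj) mul0r mulr0.
have [d d0 Pd] := mpoly_fun_small e0 P0.
have nears (c : C) : 0 < c -> \forall z \near (0 : C2), in_polydisc c z.
  by move=> c0; apply/near0_polydiscP; exists c.
have [c c0 cP] := (near0_polydiscP _).1 (filterI (nears e e0) (nears d d0)).
exists c => // z /cP [ze zd]; apply: Pe.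
  apply: in_polydisc_pt => //; rewrite normrM normCi mul1r; apply: Pd => i.
  rewrite -(@splitK 2 2 i); case: (fintype.split _) => j /=.
    by rewrite (@row_mxEl _ 1 2 2).
  by rewrite (@row_mxEr _ 1 2 2) mxE norm_conjC.
by rewrite /model /= zpart_pt wpart_pt Im_mulCi.
Qed.

(** The weight nu of Y is positive, since Y is a nonzero sum of homogeneous
    fields Z_i of positive weights and any monomial of Y occurs in some Z_i,
    which then has weight nu.  Rigidity and tangency of Y are inherited from the
    Z_i by linearity. *)
Lemma chain_decomposition_of_gc nu (Y : C3 -> C3) :
  vf_homog mu nu Y -> ~ (\forall x \near (0 : C3), Y x = 0) ->
  gc P mu Y -> chain_decomposition mu Y P.
Proof.
move=> [F [Fh YF]] Yn0 [n [Z [Zg YZ]]].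
have /choice [G GP] (i : 'I_n) : exists G : 'I_3 -> {mpoly C[3]},
    (exists2 nu, 0 < nu & forall k, whomog (wt_zw mu) (nu + wt_zw mu k) (G k)) /\
    (\forall x \near (0 : C3), forall k, Z i x 0 k = ev (G k) x).
  by have [_ _ [nu' [nu0 _ [G [Gh ZG]]]]] := Zg i; exists G; split=> //; exists nu'.
have Gnear : \forall x \near (0 : C3), forall i k, Z i x 0 k = ev (G i k) x.
  apply: (@filter_forall C3 'I_n (fun i x => forall k, Z i x 0 k = ev (G i k) x) (nbhs (0 : C3)) _).
  by move=> i; case: (GP i).
have FG k : F k = \sum_i G i k.
  apply/eqP; rewrite -subr_eq0; apply/eqP; apply: ev_eq0_near.
  near=> x.
  have YFx : forall i, Y x 0 i = ev (F i) x by near: x.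
  have YZx : Y x = \sum_i Z i x by near: x.
  have GZx : forall i k, Z i x 0 k = ev (G i k) x by near: x.
  rewrite /ev mevalB -[_.@[_] in X in X - _]YFx YZx summxE (raddf_sum (meval _)) /=.
  by apply/eqP; rewrite subr_eq0; apply/eqP/eq_bigr => i _; rewrite GZx.
have Grigid i k : (G i k)^`M(ord_max) = 0.
  have [_ br _] := Zg i; exact: (rigid_of_bracket (proj2 (GP i)) br).
have nu_gt0 : 0 < nu.
  have [k Fk0] : exists k, F k != 0.
    apply: contra_notP Yn0 => /forallNP F0.
    apply: filterS YF => x Yx; apply/rowP => k; rewrite Yx mxE.
    by have /negP/negPn/eqP -> := F0 k; rewrite /ev meval0.
  have mF := mlead_supp Fk0; set m := mlead _ in mF.
  have [i Gi] : exists i, (G i k)@_m != 0.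
    apply: contrapT => /forallNP G0; move: mF; rewrite mcoeff_msupp FG.
    rewrite (raddf_sum (mcoeff m)) big1 ?eqxx // => i _.
    by apply/eqP/negPn/negP/G0.
  have [[nu' nu'0 Gh] _] := GP i; have := whomog_coeff (Gh k) Gi.
  by rewrite (Fh k m mF) => /addIr ->.
have Frigid k : (F k)^`M(ord_max) = 0.
  by rewrite FG linear_sum big1 // => i _; apply: Grigid.
pose f (j : 'I_2) := wslice 0%MM (F (lshift 1 j)).
pose g := wslice 0%MM (F (rshift 2 (ord0 : 'I_1))).
have fh : forall j, whomog (wt mu) (nu + wt mu j) (f j).
  by move=> j; apply: wslice_homog.
have Yrow x : (forall i, Y x 0 i = ev (F i) x) ->
    (forall j, zpart (Y x) 0 j = ev (f j) (zpart x)) /\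
    wpart (Y x) = ev g (zpart x).
  move=> Yx; split=> [j|]; rewrite ?zpartE ?wpartE Yx ev_rigid //;
    exact: slice_eq0_of_deriv.
have Yaut : \forall x \near (0 : C3), model P x ->
    complex.Re (act_rho P Y x) = 0 /\ forall i, Y x 0 i = ev (F i) x.
  near=> x.
  have YFx : forall i, Y x 0 i = ev (F i) x by near: x.
  have YZx : Y x = \sum_i Z i x by near: x.
  have Ztan : forall i, model P x -> complex.Re (act_rho P (Z i) x) = 0.
    near: x; apply: (@filter_forall C3 'I_n (fun i x =>
      model P x -> complex.Re (act_rho P (Z i) x) = 0) (nbhs (0 : C3)) _).
    by move=> i; case: (Zg i) => -[].
  move=> Mx; split=> //.
  have -> : act_rho P Y x = \sum_i act_rho P (Z i) x.
    rewrite /act_rho sumrB; congr (_ - _).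
      by rewrite /wpart YZx summxE mulr_suml.
    rewrite exchange_big; apply: eq_bigr => j _; rewrite -mulr_suml.
    by rewrite zpartE YZx summxE; congr (_ * _); apply: eq_bigr => i _; rewrite zpartE.
  by rewrite raddf_sum big1 // => i _; apply: Ztan.
have [e e0 eP] := near_model_graph Yaut.
have skew : forall al be, (vderiv f (p be))@_al + Num.conj (vderiv f (p al))@_be = 0.
  apply: (skew_of_tangent P_noplh (g := g) e0 (mcoeff0_homog nu_gt0 fh)).
  move=> z /eP [tan YFx]; have [Yf Yg] := Yrow _ YFx.
  by move: tan; rewrite (act_rho_rigid _ Yf) Yg zpart_pt.
have psk : skew_family (wt mu) (vderiv f) 1 S (fun be => p be).
  split=> //; first exact: undup_uniq.
  - by move=> be; apply: slice_out.
  - exact: slice_homog.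
  - exact: slice_recursion (P_conj_swap P_real) skew.
have [||M [N [U [V [UV PE]]]]] := chain_decomposition_of_skew _ nu_gt0 _ psk.
- by move=> i; rewrite ltW // wt_gt0.
- by move=> k W; apply: vderiv_homog.
have act W x : (forall i, Y x 0 i = ev (F i) x) ->
    act_poly Y W x = ev (vderiv f W) (zpart x).
  move=> /Yrow [Yf _]; rewrite /act_poly /vderiv /ev (raddf_sum (meval _)).
  by apply: eq_bigr => j _; rewrite Yf /= mevalM.
exists M, (fun j => N j), (fun j => U j), (fun j => V j); split=> [j|z].
  have [N1 hUV DU DV rec] := UV j; split=> //.
  - by apply: filterS YF => x Yx; rewrite act // DU /ev meval0.
  - by apply: filterS YF => x Yx; rewrite act // DV /ev meval0.
  exists (fun=> 1), (fun=> -1) => k kN; have [DUk DVk] := rec k kN; split.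
  - exact: oner_neq0.
  - by rewrite oppr_eq0 oner_neq0.
  - by rewrite rmorphN rmorph1 opprK.
  - by apply: filterS YF => x Yx; rewrite act // DUk mul1r.
  - by apply: filterS YF => x Yx; rewrite act // DVk mulN1r /ev mevalN.
rewrite evzzE meval_herm_slices PE raddf_sum.
by apply: eq_bigr => j _.
Unshelve. all: by end_near. Qed.

End Model.
End MainTheorem.

(** * From chains to generalized rotations *)

(** Both sides are the contribution of one product U conj V to the skewness
    relation: on the left grouped as for p_be, on the right grouped as
    [chain_telescope] wants it. *)
Lemma skew_pair_coeff (C : numClosedFieldType) n (U V U' V' : {mpoly C[n]}) al be :
  (Num.conj V@_be *: U' + Num.conj U@_be *: V')@_al +
  Num.conj (Num.conj V@_al *: U' + Num.conj U@_al *: V')@_be =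
  U'@_al * Num.conj V@_be + U@_al * Num.conj V'@_be +
  Num.conj (U'@_be * Num.conj V@_al + U@_be * Num.conj V'@_al).
Proof.
rewrite !mcoeffD !mcoeffZ.
move: U@_al U@_be V@_al V@_be U'@_al U'@_be V'@_al V'@_be.
move=> u1 u2 v1 v2 u1' u2' v1' v2'; rewrite !rmorphD !rmorphM /= !conjCK.
rewrite [_ * u1']mulrC addrACA [_ * v1' + _]addrC.
rewrite addrACA [_ * v1']mulrC [v1 * _]mulrC.
by [].
Qed.

Section Converse.
Variable R : realType.
Local Notation C := R[i].
Local Notation C2 := 'rV[C]_2.
Local Notation C3 := 'rV[C]_3.
Local Notation wslice l F := (@slice C 2 1 l F).

(** Fixes the four variables of P as the type, so that products U conj V can be
    compared with P. *)
Definition herm4 (U V : {mpoly C[2]}) : {mpoly C[4]} := @herm C 2 U V.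

Lemma evzz_herm4 (U V : {mpoly C[2]}) (z : C2) :
  evzz (herm4 U V) z = ev U z * Num.conj (ev V z).
Proof. by rewrite evzzE (@meval_herm C 2). Qed.

Lemma mcoeff_herm4 (U V : {mpoly C[2]}) al be :
  (herm4 U V)@_(@mcat 2 2 al be) = U@_al * Num.conj V@_be.
Proof. exact: mcoeff_herm. Qed.

Lemma evzzD (P Q : {mpoly C[4]}) (z : C2) : evzz (P + Q) z = evzz P z + evzz Q z.
Proof. exact: mevalD. Qed.

Lemma evzz_sum (I : Type) (r : seq I) (Q : I -> {mpoly C[4]}) (z : C2) :
  evzz (\sum_(i <- r) Q i) z = \sum_(i <- r) evzz (Q i) z.
Proof. exact: (raddf_sum (meval _)). Qed.

Lemma evzz_herm4_pair (U V : {mpoly C[2]}) (z : C2) :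
  evzz (herm4 U V + herm4 V U) z =
  ev U z * Num.conj (ev V z) + Num.conj (ev U z * Num.conj (ev V z)).
Proof.
rewrite (rmorphM Num.conj) /= conjCK [X in _ = _ + X]mulrC.
apply: etrans (evzzD _ _ _) _.
exact: (f_equal2 +%R (evzz_herm4 U V z) (evzz_herm4 V U z)).
Qed.

Lemma mcoeff_herm4_pair (U V : {mpoly C[2]}) al be :
  (herm4 U V + herm4 V U)@_(@mcat 2 2 al be) =
  (Num.conj V@_be *: U + Num.conj U@_be *: V)@_al.
Proof.
apply: etrans (mcoeffD _ _ _) _.
rewrite mcoeffD !mcoeffZ [in RHS]mulrC [X in _ = _ + X]mulrC.
exact: (f_equal2 +%R (mcoeff_herm4 U V al be) (mcoeff_herm4 V U al be)).
Qed.

Lemma ReE2 (x : C) : (complex.Re x)%:C%C *+ 2 = x + Num.conj x.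
Proof.
case: x => a b; apply/eqP; rewrite mulr2n eq_complex /=.
by rewrite addr0 subrr !eqxx.
Qed.

Variables (mu : weight) (P : {mpoly C[4]}).
Hypothesis mu_gt0 : finite_multitype_weights mu.
Hypothesis P_real : real_valued P.
Hypothesis P_noplh : no_pluriharmonic P.
Hypothesis P_homog : whomog (wt_zz mu) 1 P.
Hypothesis P_nondeg : holo_nondegenerate P.

Local Notation p be := (@slice C 2 2 be P).
Local Notation S := (@slices C 2 2 P).

(** Such a field annihilates P, so it is complex tangent to the model. *)
Lemma killing_field_eq0 (f : 'I_2 -> {mpoly C[2]}) :
  (forall be, vderiv f (p be) = 0) -> forall j, f j = 0.
Proof.
move=> fp j.
have X0 : \forall x \near (0 : C3), poly_field (rigid_field f) x = 0.
  apply: P_nondeg; first exact: holomorphic_poly_field.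
  near=> x => _; rewrite (act_rho_rigid _ (zpart_rigid_field f x)).
  rewrite wpart_rigid_field mul0r sub0r /field_act big1 => [|be _].
    by rewrite /evzz /ev meval0 oppr0.
  by rewrite fp /herm /tensor msupp0 big_nil.
have /mpolyP f0 : rigid_field f (lshift 1 j) = 0.
  apply: ev_eq0_near; apply: filterS X0 => x /matrixP /(_ 0 (lshift 1 j)).
  by rewrite !mxE.
apply/mpolyP => al; have := f0 (@mcat 2 1 al 0%MM).
rewrite rigid_fieldl (@mcoeff_tensor C 2 1) mcoeff1 eqxx mulr1 => ->.
by rewrite !mcoeff0.
Unshelve. all: by end_near. Qed.

(** The w-expansion of Y acts on polynomials in z power by power; the right-hand
    side is free of w. *)
Lemma act_poly_slices (F : 'I_3 -> {mpoly C[3]}) (Y : C3 -> C3) U U' (c : C) :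
  (\forall x \near (0 : C3), forall i, Y x 0 i = ev (F i) x) ->
  (\forall x \near (0 : C3), act_poly Y U x = c * ev U' (zpart x)) ->
  forall l, vderiv (fun j : 'I_2 => wslice l (F (lshift 1 j))) U =
    if l == 0%MM then c *: U' else 0.
Proof.
move=> YF YU l.
(* All powers of w occurring in the two components of Y. *)
pose L := undup (flatten [seq @slices C 2 1 (F (lshift 1 j)) | j : 'I_2]).
have L0 (j : 'I_2) k : k \notin L -> wslice k (F (lshift 1 j)) = 0.
  rewrite mem_undup => kL; apply: slice_out; apply: contra kL => kL.
  by apply/flatten_mapP; exists j; rewrite ?mem_enum.
pose D k := vderiv (fun j : 'I_2 => wslice k (F (lshift 1 j))).
pose Q := \sum_(k <- L) @tensor C 2 1 (D k U) 'X_[k] - @tensor C 2 1 (c *: U') 1.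
have Q0 : Q = 0.
  apply: (@ev_eq0_near R 3); near=> x.
  have YFx : forall i, Y x 0 i = ev (F i) x by near: x.
  have YUx : act_poly Y U x = c * ev U' (zpart x) by near: x.
  rewrite /ev mevalB (raddf_sum (meval _)) -/(ev _ _) /=.
  apply/eqP; rewrite subr_eq0; apply/eqP.
  rewrite -[RHS]/(ev _ x) ev_tensor meval1 mulr1 /ev mevalZ -/(ev _ _) -YUx.
  under eq_bigr => k _ do rewrite -[meval _ _]/(ev _ x) ev_tensor.
  rewrite /act_poly.
  under [RHS]eq_bigr => j _ do
    rewrite zpartE YFx (ev_slices _ (undup_uniq _) (L0 j)) mulr_suml.
  rewrite exchange_big; apply: eq_bigr => k _.
  rewrite /D /vderiv /ev (raddf_sum (meval _)) mulr_suml; apply: eq_bigr => j _.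
  by rewrite /= mevalM mevalX big_ord1 mulrAC.
apply/mpolyP => al; move/mpolyP: Q0 => /(_ (@mcat 2 1 al l)).
rewrite mcoeff0 mcoeffB (raddf_sum (mcoeff _)) /= (@mcoeff_tensor C 2 1).
rewrite mcoeff1 => /eqP; rewrite subr_eq0 => /eqP.
have -> : \sum_(k <- L) (@tensor C 2 1 (D k U) 'X_[k])@_(mcat al l) = (D l U)@_al.
  have [lL|lL] := boolP (l \in L).
    rewrite (big_rem _ lL) /= (@mcoeff_tensor C 2 1) mcoeffX eqxx mulr1.
    rewrite big_seq big1 ?addr0 // => k; rewrite mem_rem_uniq ?undup_uniq //.
    by rewrite inE (@mcoeff_tensor C 2 1) mcoeffX => /andP [/negPf -> _]; rewrite mulr0.
  have -> : D l U = 0.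
    by rewrite /D /vderiv big1 // => j _; rewrite L0 // mul0r.
  rewrite mcoeff0 big_seq big1 // => k kL.
  rewrite (@mcoeff_tensor C 2 1) mcoeffX; case: eqP => [kl|]; last by rewrite mulr0.
  by rewrite -kl kL in lL.
by move=> ->; case: eqP => _; rewrite ?mulr1 ?mulr0 ?mcoeff0.
Unshelve. all: by end_near. Qed.

Lemma Re_act_rho_skew (f : 'I_2 -> {mpoly C[2]}) (x : C3) :
  (forall al be, (vderiv f (p be))@_al + Num.conj (vderiv f (p al))@_be = 0) ->
  complex.Re (act_rho P (poly_field (rigid_field f)) x) = 0.
Proof.
move=> skew; rewrite (act_rho_rigid _ (zpart_rigid_field f x)).
rewrite wpart_rigid_field mul0r sub0r; apply/Re_eq0.
rewrite (rmorphN Num.conj) -opprD evzzE; apply/eqP; rewrite oppr_eq0; apply/eqP.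
exact: meval_field_act_skew.
Qed.

(** Twice P is the sum T of the products U conj V and V conj U over all chain
    terms, so 2 p_be is a combination of the U's and V's with conjugate
    coefficients of V's and U's. *)
Lemma gc_of_chain_decomposition nu (Y : C3 -> C3) :
  0 < nu -> vf_homog mu nu Y ->
  (\forall x \near (0 : C3), wpart (Y x) = 0) ->
  chain_decomposition mu Y P -> gc P mu Y.
Proof.
move=> nu_gt0 [F [Fh YF]] Yw [M [N [U [V [UV PE]]]]].
pose D l := vderiv (fun j : 'I_2 => wslice l (F (lshift 1 j))).
have act := act_poly_slices YF.
pose T : {mpoly C[4]} := \sum_(j < M) \sum_(1 <= k < (N j).+1)
  (herm4 (U j k) (V j (N j - k + 1)%N) + herm4 (V j (N j - k + 1)%N) (U j k)).
(* Both sides take twice the value of P, which is real. *)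
have PT : P *+ 2 = T.
  apply/eqP; rewrite -subr_eq0; apply/eqP.
  apply: (@conj_pair_small _ _ 1) => // z _.
  have PRe : evzz P z = (complex.Re (evzz P z))%:C%C.
    by apply/eqP; rewrite eq_complex /= P_real !eqxx.
  rewrite /evzz /ev mevalB mevalMn -[meval _ P]/(evzz P z) -[meval _ T]/(evzz T z).
  rewrite PRe PE (raddf_sum (real_complex R)) -sumrMnl evzz_sum.
  rewrite -sumrB big1 // => j _.
  rewrite -[X in X *+ 2]/((complex.Re _)%:C%C) ReE2 evzz_sum.
  rewrite (rmorph_sum Num.conj) -big_split -sumrB big1 // => k _.
  by rewrite evzz_herm4_pair subrr.
have pT be : p be *+ 2 = \sum_(j < M) \sum_(1 <= k < (N j).+1)
    (Num.conj (V j (N j - k + 1)%N)@_be *: U j k +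
     Num.conj (U j k)@_be *: V j (N j - k + 1)%N).
  apply/mpolyP => al; rewrite mcoeffMn mcoeff_slice -mcoeffMn PT.
  rewrite /T !(raddf_sum (mcoeff _)) /=; apply: eq_bigr => j _.
  rewrite !(raddf_sum (mcoeff _)) /=; apply: eq_bigr => k _.
  exact: mcoeff_herm4_pair.
have DpT l be : D l (p be) *+ 2 = \sum_(j < M) \sum_(1 <= k < (N j).+1)
    (Num.conj (V j (N j - k + 1)%N)@_be *: D l (U j k) +
     Num.conj (U j k)@_be *: D l (V j (N j - k + 1)%N)).
  rewrite -(linearMn (D l)) pT linear_sum; apply: eq_bigr => j _.
  rewrite linear_sum; apply: eq_bigr => k _.
  by rewrite linearD !linearZ.
have mul2_eq0 (q : {mpoly C[2]}) : q *+ 2 = 0 -> q = 0.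
  move=> /mpolyP q0; apply/mpolyP => m; apply/eqP; move: (q0 m).
  by rewrite mcoeffMn !mcoeff0 => /eqP; rewrite mulrn_eq0.
have relU j k : (1 <= k <= N j)%N -> exists U' c,
    \forall x \near (0 : C3), act_poly Y (U j k) x = c * ev U' (zpart x).
  move=> /andP [k1]; rewrite leq_eqVlt => /orP [/eqP ->|kN].
    have [_ _ UN _ _] := UV j; exists 0, 0.
    by apply: filterS UN => x ->; rewrite mul0r.
  have [_ _ _ _ [c [d /(_ k)]]] := UV j; rewrite k1 kN => -[] // _ _ _ rU _.
  by exists (U j k.+1), (c k).
have relV j k : (1 <= k <= N j)%N -> exists U' c,
    \forall x \near (0 : C3), act_poly Y (V j k) x = c * ev U' (zpart x).
  move=> /andP [k1]; rewrite leq_eqVlt => /orP [/eqP ->|kN].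
    have [_ _ _ VN _] := UV j; exists 0, 0.
    by apply: filterS VN => x ->; rewrite mul0r.
  have [_ _ _ _ [c [d /(_ k)]]] := UV j; rewrite k1 kN => -[] // _ _ _ _ rV.
  by exists (V j k.+1), (d k).
have rev_range j k : (1 <= k < (N j).+1)%N -> (1 <= N j - k + 1 <= N j)%N.
  by move=> /andP [k1 kN]; rewrite addn1 /= ltn_subrL k1 (leq_trans k1).
have rigid l : l != 0%MM -> forall j : 'I_2, wslice l (F (lshift 1 j)) = 0.
  move=> l0; apply: killing_field_eq0 => be; apply: mul2_eq0.
  rewrite -/(D l _) DpT big1 // => j _; rewrite big_nat big1 // => k kN.
  have [U' [c /act /(_ l)]] := relU j k kN.
  rewrite (negPf l0) -/(D l _) => ->.
  have [V' [c' /act /(_ l)]] := relV j _ (rev_range j k kN).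
  by rewrite (negPf l0) -/(D l _) => ->; rewrite !scaler0 addr0.
pose f (j : 'I_2) := wslice 0%MM (F (lshift 1 j)).
have fh : forall j, whomog (wt mu) (nu + wt mu j) (f j).
  by move=> j; apply: wslice_homog.
have YE : \forall x \near (0 : C3), Y x = poly_field (rigid_field f) x.
  near=> x.
  have YFx : forall i, Y x 0 i = ev (F i) x by near: x.
  have Ywx : wpart (Y x) = 0 by near: x.
  apply/rowP => i; rewrite -(@splitK 2 1 i); case: (fintype.split _) => j.
    rewrite -[LHS]zpartE -[RHS]zpartE zpart_rigid_field zpartE YFx ev_rigid //.
    by move=> l /rigid.
  by rewrite ord1 -[LHS]wpartE -[RHS]wpartE wpart_rigid_field.
have skewT j al be : \sum_(1 <= k < (N j).+1)
    ((D 0%MM (U j k))@_al * Num.conj (V j (N j - k + 1)%N)@_be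
     + (U j k)@_al * Num.conj (D 0%MM (V j (N j - k + 1)%N))@_be) = 0.
  have [N1 _ UN VN [c [d rec]]] := UV j.
  have D0 W : (\forall x \near (0 : C3), act_poly Y W x = 0) -> D 0%MM W = 0.
    move=> W0; have := act W 0 0 _ 0%MM; rewrite eqxx scaler0; apply.
    by apply: filterS W0 => x ->; rewrite mul0r.
  apply: (chain_telescope (u := fun k => (U j k)@_al) (v := fun k => (V j k)@_be)
    (Du := fun k => (D 0%MM (U j k))@_al) (Dv := fun k => (D 0%MM (V j k))@_be)
    (c := c) (d := d)).
  - by rewrite (D0 _ UN) mcoeff0.
  - by rewrite (D0 _ VN) mcoeff0.
  move=> k kN; have [_ _ cd rU rV] := rec k kN; split=> //.
    by have := act _ _ _ rU 0%MM; rewrite eqxx -/(D _ _) => ->; rewrite mcoeffZ.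
  by have := act _ _ _ rV 0%MM; rewrite eqxx -/(D _ _) => ->; rewrite mcoeffZ.
have skew al be :
    (vderiv f (p be))@_al + Num.conj (vderiv f (p al))@_be = 0.
  rewrite -!/(D 0%MM _).
  suff : ((D 0%MM (p be))@_al + Num.conj (D 0%MM (p al))@_be) *+ 2 = 0.
    by move/eqP; rewrite mulrn_eq0 => /eqP.
  rewrite mulrnDl -(rmorphMn Num.conj) /=.
  rewrite -!mcoeffMn !DpT !(raddf_sum (mcoeff _)) (rmorph_sum Num.conj) /=.
  rewrite -big_split big1 //= => j _.
  rewrite !(raddf_sum (mcoeff _)) (rmorph_sum Num.conj) /=.
  have := f_equal2 +%R (skewT j al be) (f_equal Num.conj (skewT j be al)).
  rewrite (rmorph0 Num.conj) addr0 (rmorph_sum Num.conj) -!big_split => E.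
  rewrite -[RHS]E; apply: eq_bigr => k _.
  exact: skew_pair_coeff.
have [nu1|nu1] := ltP nu 1.
  exists 1%N, (fun=> poly_field (rigid_field f)); split=> [_|]; last first.
    by apply: filterS YE => x ->; rewrite big_ord1.
  split.
  - split; first exact: holomorphic_poly_field.
    by near=> x => _; apply: Re_act_rho_skew.
  - by near=> x; apply: rigid_field_bracket.
  exists nu; split=> //; exists (rigid_field f); split.
    exact: rigid_field_homog.
  by near=> x => i; rewrite mxE.
(* If (D p_be)_al <> 0, then p_be and p_al are nonzero, so al and be have weight
   < 1; but their weights add up to 1 + nu >= 2. *)
have f0 : forall j, f j = 0.
  apply: killing_field_eq0 => be; apply/mpolyP => al; rewrite mcoeff0.
  apply/eqP; apply: contraT => c0.
  have pbe : p be != 0.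
    by apply: contraNneq c0 => ->; rewrite linear0 mcoeff0.
  have pal : p al != 0.
    apply: contraNneq c0 => pal; have := skew al be.
    by rewrite pal linear0 mcoeff0 (rmorph0 Num.conj) addr0 => ->.
  have := whomog_coeff (vderiv_homog fh (slice_homog (be := be) P_homog)) c0.
  have := slice_wdeg_lt1 mu_gt0 P_real P_noplh P_homog pbe.
  have := slice_wdeg_lt1 mu_gt0 P_real P_noplh P_homog pal.
  move=> al1 be1 /eqP; rewrite lt_eqF //.
  apply: lt_le_trans al1 _; apply: le_trans nu1 _.
  by rewrite lerDr subr_ge0 ltW.
exists 0%N, (fun _ => fun=> 0); split=> [[] //|].
apply: filterS YE => x ->; rewrite big_ord0; apply/rowP => i.
rewrite -(@splitK 2 1 i); case: (fintype.split _) => j.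
  by rewrite -[LHS]zpartE zpart_rigid_field f0 /ev meval0 mxE.
by rewrite ord1 -[LHS]wpartE wpart_rigid_field mxE.
Unshelve. all: by end_near. Qed.
End Converse.

Unset Implicit Arguments.

Theorem theorem1p5 (R : realType) (mu : weight) (P : {mpoly R[i][4]})
    (P_real : real_valued P)
    (P_noplh : no_pluriharmonic P)
    (mu_multitype : multitype_weights (model P) mu)
    (mu_finite : finite_multitype_weights mu)
    (P_homog : whomog (wt_zz mu) 1 P)
    (P_nondeg : holo_nondegenerate P) :
  (forall (nu : rat) (Y : 'rV[R[i]]_3 -> 'rV[R[i]]_3),
      vf_homog mu nu Y ->
      ~ (\forall x \near (0 : 'rV[R[i]]_3), Y x = 0) ->
      gc P mu Y ->
      chain_decomposition mu Y P) /\
  (forall (nu : rat) (Y : 'rV[R[i]]_3 -> 'rV[R[i]]_3),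
      0 < nu ->
      vf_homog mu nu Y ->
      (\forall x \near (0 : 'rV[R[i]]_3), wpart (Y x) = 0) ->
      chain_decomposition mu Y P ->
      gc P mu Y).
Proof.
split=> [nu Y Yh Yn0 Ygc|nu Y nu0 Yh Yw Ychains].
  exact: (chain_decomposition_of_gc mu_finite P_real P_noplh P_homog Yh Yn0 Ygc).
exact: (gc_of_chain_decomposition mu_finite P_real P_noplh P_homog P_nondeg
  nu0 Yh Yw Ychains).
Qed.
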